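(* Let $x>0$ be fixed, let $$F_{i\nu}(x)=\frac{1}{2\cosh \frac12\pi\nu}\{J_{i\nu}(x)+J_{-i\nu}(x)\},\qquad G_{i\nu}(x)=\frac{1}{2i\sinh \frac12\pi\nu}\{J_{i\nu}(x)-J_{-i\nu}(x)\},$$ and put $\lambda=2/(ex)$ and $m_\pm=(n\pm\frac14)\pi$. With the labelling of zeros specified in the context, the $n$th positive $\nu$-zero of $F_{i\nu}(x)$ satisfies $$\nu_n\sim \frac{m_+}{W(\lambda m_+)}+\frac{B_0}{m_+}+\frac{B_1}{m_+^3}+\frac{B_2}{m_+^5}+\cdots\qquad (n\to\infty),$$ and the $n$th positive $\nu$-zero of $G_{i\nu}(x)$ satisfies $$\nu_n\sim \frac{m_-}{W(\lambda m_-)}+\frac{B_0}{m_-}+\frac{B_1}{m_-^3}+\frac{B_2}{m_-^5}+\cdots\qquad (n\to\infty),$$ where the coefficients $B_0,B_1,B_2$ (which depend on $x$ and $n$) are those defined in the context with $m=m_+$ for $F_{i\nu}(x)$ and $m=m_-$ for $G_{i\nu}(x)$. Here $\sim$ means that, with $m=m_+$ or $m=m_-$ respectively and $\xi_n=m/W(\lambda m)$, for each $K\in\{0,1,2\}$, $$\nu_n=\xi_n+\sum_{k=0}^{K}\frac{B_k}{m^{2k+1}}+O\bigl(\xi_n^{-(2K+3)}\bigr)\qquad (n\to\infty).$$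
   Context: $J_{\pm i\nu}(x)$ is the Bessel function of the first kind of order $\pm i\nu$, with $J_{i\nu}(x)=\frac{(x/2)^{i\nu}}{\Gamma(1+i\nu)}\sum_{k\ge0}\frac{(-1)^k(x/2)^{2k}}{k!\,(1+i\nu)_k}$, where $(a)_k=\Gamma(a+k)/\Gamma(a)$. For $z>0$, $W(z)$ is the Lambert function: the positive solution of $W(z)e^{W(z)}=z$. A $\nu$-zero is a zero of the function regarded as a function of the real variable $\nu>0$ with $x>0$ fixed. Labelling of zeros: let $\Phi(\nu)=\nu\log(\lambda\nu)+\frac{\pi}{4}$ with $\lambda=2/(ex)$. The large positive zeros are labelled by large positive integers $n$ so that $\Phi(\nu_n)=(n+\frac12)\pi-\epsilon_n$ for $F_{i\nu}(x)$, and $\Phi(\nu_n)=n\pi-\epsilon_n$ for $G_{i\nu}(x)$, with $\epsilon_n\to0$ as $n\to\infty$. Stirling coefficients: $\gamma_0=1$, $\gamma_1=-\frac1{12}$, $\gamma_2=\frac1{288}$, $\gamma_3=\frac{139}{51840}$, $\gamma_4=-\frac{571}{2488320}$, $\gamma_5=-\frac{163879}{209018880}$. Polynomials: $C_0(c)=1$, $C_1(c)=c$, $C_2(c)=\frac c2(-2+c)$, $C_3(c)=\frac c6(6-9c+c^2)$, $C_4(c)=\frac c{24}(-24+84c-24c^2+c^3)$, $C_5(c)=\frac c{120}(120-900c+500c^2-50c^3+c^4)$. With $c=x^2/4$ set $\hat a_0=1$ and $\hat a_k=C_k(-c)+\sum_{r=1}^k\gamma_rC_{k-r}(-c)$ for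 $1\le k\le5$. Then $A_0=\hat a_1$, $A_1=\hat a_1\hat a_2-\hat a_3-\frac13\hat a_1^3$, $A_2=\hat a_1\hat a_2^2+\hat a_1^2\hat a_3-\hat a_1^3\hat a_2-\hat a_2\hat a_3-\hat a_1\hat a_4+\hat a_5+\frac15\hat a_1^5$. For $m>0$ put $\xi=m/W(\lambda m)$ (so that $\xi\log(\lambda\xi)=m$) and $\rho=\xi/m$ (so that $1+\log(\lambda\xi)=(1+\rho)/\rho$). Define $b_0=\dfrac{-A_0}{1+\log(\lambda\xi)}$, $\quad b_1=\dfrac{A_0b_0-A_1-\frac12b_0^2}{1+\log(\lambda\xi)}$, and $$B_0=\frac{-A_0}{1+\rho},\qquad B_1=\frac{A_0b_0-A_1-\frac12b_0^2}{\rho^2(1+\rho)},\qquad B_2=\frac{3A_1b_0-A_0(b_0^2-b_1)-A_2-b_0b_1+\frac16b_0^3}{\rho^4(1+\rho)}.$$ *)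

(* Defs.v *)
From Stdlib Require Import Reals Factorial ClassicalEpsilon.
From Coquelicot Require Import Coquelicot.

Open Scope R_scope.

(* Limits and sums of complex sequences are taken componentwise, as Coquelicot
   does for [C_lim]; the value is meaningful only when the limit exists. *)
Definition Clim_seq (u : nat -> C) : C :=
  (real (Lim_seq (fun n => Re (u n))), real (Lim_seq (fun n => Im (u n)))).

Definition CSeries (a : nat -> C) : C := Clim_seq (sum_n a).

Definition Cexp (z : C) : C := (exp (Re z) * cos (Im z), exp (Re z) * sin (Im z)).

(* [t ^ z] for [t > 0], principal value. *)
Definition RCpower (t : R) (z : C) : C := Cexp (RtoC (ln t) * z)%C.

(* z (z + 1) ... (z + n) *)
Fixpoint Cshift_prod (z : C) (n : nat) : C :=
  match n with
  | O => z
  | S p => (Cshift_prod z p * (z + INR n))%C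
  end.

(* The Gamma function, by Euler's limit
   Gamma(z) = lim n! n^z / (z (z + 1) ... (z + n)),
   valid at every complex z other than 0, -1, -2, ... *)
Definition CGamma (z : C) : C :=
  Clim_seq (fun n => (INR (fact n) * RCpower (INR n) z / Cshift_prod z n)%C).

Definition pochhammer (a : C) (k : nat) : C :=
  (CGamma (a + INR k) / CGamma a)%C.

Definition BesselJ (mu : C) (x : R) : C :=
  (RCpower (x / 2) mu / CGamma (1 + mu) *
   CSeries (fun k => (-1) ^ k * (x / 2) ^ (2 * k) /
                     (INR (fact k) * pochhammer (1 + mu) k)))%C.

Definition BesselF (x nu : R) : C :=
  (/ (2 * cosh (PI * nu / 2)) * (BesselJ (Ci * nu) x + BesselJ (- (Ci * nu)) x))%C.

Definition BesselG (x nu : R) : C :=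
  (/ (2 * Ci * sinh (PI * nu / 2)) * (BesselJ (Ci * nu) x - BesselJ (- (Ci * nu)) x))%C.

(* For [z > 0], the unique positive solution [w] of [w * exp w = z]. *)
Definition LambertW (z : R) : R :=
  epsilon (inhabits 0) (fun w => 0 < w /\ w * exp w = z).

Definition lambda (x : R) : R := 2 / (exp 1 * x).

Definition Phi (x nu : R) : R := nu * ln (lambda x * nu) + PI / 4.

(* [nu] labels the large positive zeros of [Z] by the large integers, with
   Phi(nu n) = theta n - o(1).  Only the behaviour for large [n] matters: the
   values [nu n] for small [n] are arbitrary. *)
Definition labels_zeros (x : R) (Z : R -> C) (theta : nat -> R) (nu : nat -> R) : Prop :=
  eventually (fun n => 0 < nu n /\ Z (nu n) = 0) /\
  (exists T : R, forall v : R, T < v -> Z v = 0 -> exists! n : nat, nu n = v) /\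
  is_lim_seq (fun n => theta n - Phi x (nu n)) 0.

(* Coefficients in the large-z expansion of 1 / Gamma(z), normalised by its
   leading Stirling approximation; used only for indices up to 5. *)
Definition stirling_gamma (k : nat) : R :=
  match k with
  | 0%nat => 1
  | 1%nat => - (1 / 12)
  | 2%nat => 1 / 288
  | 3%nat => 139 / 51840
  | 4%nat => - (571 / 2488320)
  | 5%nat => - (163879 / 209018880)
  | _ => 0
  end.

Definition Cpoly (k : nat) (c : R) : R :=
  match k with
  | 0%nat => 1
  | 1%nat => c
  | 2%nat => c / 2 * (-2 + c)
  | 3%nat => c / 6 * (6 - 9 * c + c ^ 2)
  | 4%nat => c / 24 * (-24 + 84 * c - 24 * c ^ 2 + c ^ 3)
  | 5%nat => c / 120 * (120 - 900 * c + 500 * c ^ 2 - 50 * c ^ 3 + c ^ 4)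
  | _ => 0
  end.

(* For [k = 0] the sum over the empty range [1 <= r <= 0] is [0], so the value
   is [1]. *)
Definition ahat (x : R) (k : nat) : R :=
  let c := x ^ 2 / 4 in
  Cpoly k (- c) + sum_n_m (fun r => stirling_gamma r * Cpoly (k - r) (- c)) 1 k.

Definition A0 (x : R) : R := ahat x 1.

Definition A1 (x : R) : R :=
  ahat x 1 * ahat x 2 - ahat x 3 - 1 / 3 * ahat x 1 ^ 3.

Definition A2 (x : R) : R :=
  ahat x 1 * ahat x 2 ^ 2 + ahat x 1 ^ 2 * ahat x 3 - ahat x 1 ^ 3 * ahat x 2
  - ahat x 2 * ahat x 3 - ahat x 1 * ahat x 4 + ahat x 5 + 1 / 5 * ahat x 1 ^ 5.

Definition xi (x m : R) : R := m / LambertW (lambda x * m).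

Definition rho (x m : R) : R := xi x m / m.

Definition b0 (x m : R) : R := - A0 x / (1 + ln (lambda x * xi x m)).

Definition b1 (x m : R) : R :=
  (A0 x * b0 x m - A1 x - 1 / 2 * b0 x m ^ 2) / (1 + ln (lambda x * xi x m)).

Definition B0 (x m : R) : R := - A0 x / (1 + rho x m).

Definition B1 (x m : R) : R :=
  (A0 x * b0 x m - A1 x - 1 / 2 * b0 x m ^ 2) / (rho x m ^ 2 * (1 + rho x m)).

Definition B2 (x m : R) : R :=
  (3 * A1 x * b0 x m - A0 x * (b0 x m ^ 2 - b1 x m) - A2 x - b0 x m * b1 x m
   + 1 / 6 * b0 x m ^ 3) / (rho x m ^ 4 * (1 + rho x m)).

(* Used only for [k <= 2]. *)
Definition B (x m : R) (k : nat) : R :=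
  match k with
  | 0%nat => B0 x m
  | 1%nat => B1 x m
  | 2%nat => B2 x m
  | _ => 0
  end.

Definition zero_expansion (x : R) (m : nat -> R) (nu : nat -> R) : Prop :=
  forall K : nat, (K <= 2)%nat ->
  exists M : R, eventually (fun n =>
    Rabs (nu n - (xi x (m n) + sum_f_R0 (fun k => B x (m n) k / m n ^ (2 * k + 1)) K))
    <= M * / xi x (m n) ^ (2 * K + 3)).

Definition m_plus (n : nat) : R := (INR n + 1 / 4) * PI.

Definition m_minus (n : nat) : R := (INR n - 1 / 4) * PI.

(* Main.v *)
From Stdlib Require Import Reals Lra Lia ZArith Ranalysis5 ClassicalEpsilon.
From Coquelicot Require Import Coquelicot.
Require Import Defs.

Open Scope R_scope.

(** For [mu = i nu] with [nu] real, [J_mu] and [J_(-mu)] are complex conjugates, so the zeros of [F] and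
    [G] are the points where the phase of [J_(i nu)(x)] is an odd multiple of [PI / 2], resp. a
    multiple of [PI].  Minus this phase is, for large [nu], a continuous increasing function
    [bessel_phase] with

      [bessel_phase nu = Phi nu + A0 / nu + A1 / nu^3 + A2 / nu^5 + O(nu^-7)]

    ([bessel_phase_expand], [bessel_phase_monotone]).  Continuity and monotonicity give exactly one
    large zero for each admissible value of the phase, hence the labelling.  The expansion turns the
    equation for the labelled zero into [nu ln (lambda nu) + A0 / nu + A1 / nu^3 + A2 / nu^5 = m] up to
    [O(nu^-7)].  Its leading part is solved exactly by [xi = m / W (lambda m)], and the [b_k] are
    determined by substituting [xi + b0 / xi + b1 / xi^3 + b2 / xi^5] and comparing powers of [1 / xi].
    Since the left-hand side has derivative at least [1] for large [nu], a residual [O(xi^-7)] is also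
    the error of the solution ([zero_expansion_of_trunc_phase]).

    The phase has three parts: [nu ln (x/2)], the argument of the power series, and minus the argument
    of [Gamma (1 + i nu)].

    In Euler's limit the argument of [Gamma (1 + i nu)] is [nu ln n - sum_j arg (j + i nu)].  The
    imaginary part of the Stirling series satisfies the functional equation of [Gamma] up to
    [O(z^-8)] at [z = j + i nu] ([stirling_defect_le]); summing this over [j] gives both the
    convergence and Stirling's formula with error [O(nu^-7)] ([gamma_phase_lim]).  The increments of
    the same sums show that the slope of the argument grows like [ln nu] ([gamma_phase_increment]).

    The power series is [sum_k (-x^2/4)^k / (k! (1 + i nu)_k)].  Its terms with [k >= 7] contribute
    [O(nu^-7)], the others are expanded in [1 / (i nu)]; taking the arctangent of the quotient of
    imaginary and real part gives its argument ([bessel_arg_expand]).  It is Lipschitz in [nu], so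
    it does not disturb the monotonicity of the phase. *)

(** * Asymptotic bounds along a filter *)

Definition bigO {T : Type} (F : (T -> Prop) -> Prop) (t : T -> R) (k : nat)
  (f : T -> R) : Prop :=
  exists M : R, F (fun p => Rabs (f p) <= M * t p ^ k).

(** The bound [t <= 1] makes [O(t ^ k)] decreasing in [k], so that orders may be lowered freely. *)
Definition scale {T : Type} (F : (T -> Prop) -> Prop) (t : T -> R) : Prop :=
  F (fun p => 0 < t p <= 1).

Lemma bigO_ext {T} (F : (T -> Prop) -> Prop) {FF : Filter F} t k (f g : T -> R) :
  F (fun p => f p = g p) -> bigO F t k f -> bigO F t k g.
Proof.
  intros H [M HM]. exists M.
  generalize (filter_and _ _ H HM). apply filter_imp.
  intros p [E L]. rewrite <- E. exact L.
Qed.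

Lemma bigO_nonneg {T} (F : (T -> Prop) -> Prop) {FF : Filter F} t k (f : T -> R) :
  scale F t -> bigO F t k f ->
  exists M, 0 <= M /\ F (fun p => Rabs (f p) <= M * t p ^ k).
Proof.
  intros Ht [M HM]. exists (Rabs M). split; [apply Rabs_pos|].
  generalize (filter_and _ _ Ht HM). apply filter_imp.
  intros p [Hp L]. apply Rle_trans with (1 := L).
  apply Rmult_le_compat_r; [apply pow_le; lra | apply Rle_abs].
Qed.

Lemma bigO_le {T} (F : (T -> Prop) -> Prop) {FF : Filter F} t k (f g : T -> R) :
  F (fun p => Rabs (g p) <= Rabs (f p)) -> bigO F t k f -> bigO F t k g.
Proof.
  intros H [M HM]. exists M.
  generalize (filter_and _ _ H HM). apply filter_imp.
  intros p [E L]. lra.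
Qed.

Lemma bigO_plus {T} (F : (T -> Prop) -> Prop) {FF : Filter F} t k (f g : T -> R) :
  bigO F t k f -> bigO F t k g -> bigO F t k (fun p => f p + g p).
Proof.
  intros [M HM] [N HN]. exists (M + N).
  generalize (filter_and _ _ HM HN). apply filter_imp.
  intros p [L1 L2]. apply Rle_trans with (1 := Rabs_triang _ _). lra.
Qed.

Lemma bigO_opp {T} (F : (T -> Prop) -> Prop) {FF : Filter F} t k (f : T -> R) :
  bigO F t k f -> bigO F t k (fun p => - f p).
Proof.
  intros [M HM]. exists M. revert HM. apply filter_imp.
  intros p. now rewrite Rabs_Ropp.
Qed.

Lemma bigO_minus {T} (F : (T -> Prop) -> Prop) {FF : Filter F} t k (f g : T -> R) :
  bigO F t k f -> bigO F t k g -> bigO F t k (fun p => f p - g p).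
Proof.
  intros Hf Hg. exact (bigO_plus F t k _ _ Hf (bigO_opp F t k _ Hg)).
Qed.

Lemma bigO_mult {T} (F : (T -> Prop) -> Prop) {FF : Filter F} t j k (f g : T -> R) :
  bigO F t j f -> bigO F t k g -> bigO F t (j + k) (fun p => f p * g p).
Proof.
  intros [M HM] [N HN]. exists (M * N).
  generalize (filter_and _ _ HM HN). apply filter_imp.
  intros p [L1 L2]. rewrite Rabs_mult, pow_add.
  replace (M * N * (t p ^ j * t p ^ k)) with ((M * t p ^ j) * (N * t p ^ k)) by ring.
  apply Rmult_le_compat; auto using Rabs_pos.
Qed.

Lemma bigO_const {T} (F : (T -> Prop) -> Prop) {FF : Filter F} t (c : R) :
  bigO F t 0 (fun _ => c).
Proof.
  exists (Rabs c). apply filter_forall. intros p. simpl. lra.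
Qed.

Lemma bigO_scale {T} (F : (T -> Prop) -> Prop) {FF : Filter F} t k :
  scale F t -> bigO F t k (fun p => t p ^ k).
Proof.
  intros Ht. exists 1. unfold scale in Ht. revert Ht. apply filter_imp. intros p Hp.
  rewrite Rabs_pos_eq; [lra | apply pow_le; lra].
Qed.

Lemma bigO_weaken {T} (F : (T -> Prop) -> Prop) {FF : Filter F} t j k (f : T -> R) :
  scale F t -> (k <= j)%nat -> bigO F t j f -> bigO F t k f.
Proof.
  intros Ht Hkj Hf. destruct (bigO_nonneg F t j f Ht Hf) as [M [M0 HM]].
  exists M. generalize (filter_and _ _ Ht HM). apply filter_imp.
  intros p [Hp L]. apply Rle_trans with (1 := L).
  apply Rmult_le_compat_l; [exact M0|].
  replace j with (k + (j - k))%nat by lia. rewrite pow_add.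
  rewrite <- (Rmult_1_r (t p ^ k)) at 2.
  apply Rmult_le_compat_l; [apply pow_le; lra|].
  rewrite <- (pow1 (j - k)). apply pow_incr. lra.
Qed.

Lemma bigO_factor {T} (F : (T -> Prop) -> Prop) {FF : Filter F} t k (f : T -> R) :
  scale F t -> bigO F t 0 f -> bigO F t k (fun p => t p ^ k * f p).
Proof.
  intros Ht Hf. replace k with (k + 0)%nat at 1 by lia.
  apply bigO_mult; auto. now apply bigO_scale.
Qed.

Lemma bigO_mult_bounded {T} (F : (T -> Prop) -> Prop) {FF : Filter F} t k (f g : T -> R) :
  bigO F t 0 f -> bigO F t k g -> bigO F t k (fun p => f p * g p).
Proof. exact (bigO_mult F t 0 k f g). Qed.

Lemma bigO_pow_bounded {T} (F : (T -> Prop) -> Prop) {FF : Filter F} t (f : T -> R) j :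
  bigO F t 0 f -> bigO F t 0 (fun p => f p ^ j).
Proof.
  intros Hf. induction j as [|j IH]; simpl.
  - apply bigO_const; auto.
  - now apply (bigO_mult_bounded F t 0).
Qed.

Lemma bigO_scale_bounded {T} (F : (T -> Prop) -> Prop) {FF : Filter F} t :
  scale F t -> bigO F t 0 t.
Proof.
  intros Ht. apply bigO_weaken with (j := 1%nat); [exact FF|exact Ht|lia|].
  apply bigO_ext with (f := fun p => t p ^ 1); [exact FF| |].
  - apply filter_forall. intros p. ring.
  - now apply bigO_scale.
Qed.

(** The only place where the scale has to tend to [0], and not just to stay below [1]. *)
Lemma bigO_small {T} (F : (T -> Prop) -> Prop) {FF : Filter F} t (f : T -> R) :
  filterlim t F (locally 0) -> scale F t -> bigO F t 1 f ->
  forall e, 0 < e -> F (fun p => Rabs (f p) < e).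
Proof.
  intros Hl Ht Hf e He.
  destruct (bigO_nonneg F t 1 f Ht Hf) as [M [M0 HM]].
  assert (Hd : 0 < e / (M + 1)) by (apply Rdiv_lt_0_compat; lra).
  assert (Hs : F (fun p => ball 0 (mkposreal _ Hd) (t p)))
    by (apply (proj1 (filterlim_locally t 0) Hl)).
  generalize (filter_and _ _ Ht (filter_and _ _ Hs HM)). apply filter_imp.
  intros p [Hp [B L]].
  unfold ball in B; simpl in B; unfold AbsRing_ball, abs, minus, plus, opp in B; simpl in B.
  rewrite Ropp_0, Rplus_0_r, Rabs_pos_eq in B by lra.
  apply Rle_lt_trans with (1 := L). rewrite pow_1.
  apply Rle_lt_trans with ((M + 1) * t p); [nra|].
  apply Rlt_le_trans with ((M + 1) * (e / (M + 1))); [apply Rmult_lt_compat_l; lra|].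
  right; field; lra.
Qed.

(** Proves [bigO F t 0 f] by following the syntax of [f]. *)
Ltac bounded :=
  repeat first
    [ assumption
    | apply bigO_const; [typeclasses eauto]
    | apply bigO_scale_bounded; [typeclasses eauto | assumption]
    | apply bigO_plus; [typeclasses eauto | |]
    | apply bigO_minus; [typeclasses eauto | |]
    | apply bigO_opp; [typeclasses eauto |]
    | apply bigO_mult_bounded; [typeclasses eauto | |]
    | apply bigO_pow_bounded; [typeclasses eauto |] ].

(** * One step of Stirling's series *)

Lemma is_derive_add (f g : R -> R) (x df dg : R) :
  is_derive f x df -> is_derive g x dg -> is_derive (fun y => f y + g y) x (df + dg).
Proof. exact (@is_derive_plus R_AbsRing _ f g x df dg). Qed.

Lemma is_derive_mul (f g : R -> R) (x df dg : R) :
  is_derive f x df -> is_derive g x dg ->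
  is_derive (fun y => f y * g y) x (df * g x + f x * dg).
Proof. intros. apply (@is_derive_mult R_AbsRing f g x df dg); auto. intros; apply Rmult_comm. Qed.

Lemma MVT_is_derive (f df : R -> R) (a b : R) : a < b ->
  (forall c, a <= c <= b -> is_derive f c (df c)) ->
  exists c, f b - f a = df c * (b - a) /\ a < c < b.
Proof.
  intros Hab H. apply MVT_cor2; [exact Hab|].
  intros c Hc. apply is_derive_Reals. now apply H.
Qed.

Lemma sqr_sum_pos (nu t : R) : 0 < nu -> 0 < t ^ 2 + nu ^ 2.
Proof. intros H. nra. Qed.

(** The argument of [t + i nu] for [nu > 0], written so that it also makes sense at [t = 0]. *)
Definition theta (nu t : R) : R := PI / 2 - atan (t / nu).

(** The power [1 / z ^ k] at [z = t + i nu].  As [t] moves parallel to the real axis, real and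
    imaginary parts are differentiated as the real functions of [t] that they are. *)
Definition ipow (nu : R) (k : nat) (t : R) : C := ((/ ((t, nu) : C)) ^ k)%C.

(** This is [(z ^ -k)' = - k z ^ (-k-1)] along a line parallel to the real axis; the induction
    multiplies by [1 / z], whose two parts are the functions [a] and [b]. *)
Lemma is_derive_ipow (nu t : R) (k : nat) : 0 < nu ->
  is_derive (fun u => Re (ipow nu k u)) t (- INR k * Re (ipow nu (S k) t)) /\
  is_derive (fun u => Im (ipow nu k u)) t (- INR k * Im (ipow nu (S k) t)).
Proof.
  intros Hnu.
  assert (HR : is_derive (fun u => u / (u ^ 2 + nu ^ 2)) t
      (- Re (ipow nu 2 t))).
  { pose proof (sqr_sum_pos nu t Hnu).
    unfold ipow; simpl; auto_derive; [simpl in *; lra|]. simpl in *. field. lra. }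
  assert (HI : is_derive (fun u => - nu / (u ^ 2 + nu ^ 2)) t (- Im (ipow nu 2 t))).
  { pose proof (sqr_sum_pos nu t Hnu).
    unfold ipow; simpl; auto_derive; [simpl in *; lra|]. simpl in *. field. lra. }
  induction k as [|k [IHR IHI]].
  - split; simpl Re; simpl Im;
    (evar_last; [apply (@is_derive_const R_AbsRing R_NormedModule)| simpl; unfold zero; simpl; ring]).
  - set (a := fun u : R => u / (u ^ 2 + nu ^ 2)) in *.
    set (b := fun u : R => - nu / (u ^ 2 + nu ^ 2)) in *.
    assert (HS : forall j u, ipow nu (S j) u =
       (a u * Re (ipow nu j u) - b u * Im (ipow nu j u),
        a u * Im (ipow nu j u) + b u * Re (ipow nu j u))).
    { intros j u. unfold ipow. rewrite Cpow_S. unfold a, b.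
      destruct ((/ (u, nu)) ^ j)%C as [p q]. unfold Cmult, Cinv; simpl. reflexivity. }
    assert (H2 : ipow nu 2 t = (a t * a t - b t * b t, 2 * a t * b t)).
    { rewrite !HS. unfold ipow; simpl. apply injective_projections; simpl; ring. }
    assert (HSS : ipow nu (S (S k)) t = (ipow nu 2 t * ipow nu k t)%C).
    { unfold ipow. rewrite <- Cpow_add_r. reflexivity. }
    split.
    + apply is_derive_ext with (fun u => a u * Re (ipow nu k u) + b u * (- 1 * Im (ipow nu k u))).
      { intros u. rewrite HS; simpl; ring. }
      evar_last.
      { apply is_derive_add; [apply is_derive_mul; [exact HR|exact IHR]|].
        apply is_derive_mul; [exact HI|]. apply is_derive_mul; [|exact IHI].
        apply (@is_derive_const R_AbsRing R_NormedModule). }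
      unfold zero; cbv beta. rewrite HSS. rewrite S_INR, re_mult, !H2, !HS. simpl. ring.
    + apply is_derive_ext with (fun u => a u * Im (ipow nu k u) + b u * Re (ipow nu k u)).
      { intros u. rewrite HS; simpl; ring. }
      evar_last.
      { apply is_derive_add; apply is_derive_mul; [exact HR|exact IHI|exact HI|exact IHR]. }
      cbv beta. rewrite HSS. rewrite S_INR, im_mult, !H2, !HS. simpl. ring.
Qed.

Lemma Cmod_pair (nu t : R) : Cmod (t, nu) = sqrt (t ^ 2 + nu ^ 2).
Proof. reflexivity. Qed.

Lemma Im_ipow8_le (nu t : R) : 0 < nu ->
  Rabs (Im (ipow nu 8 t)) <= / (t ^ 2 + nu ^ 2) ^ 4.
Proof.
  intros Hnu. pose proof (sqr_sum_pos nu t Hnu) as Hp.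
  assert (Hz : ((t, nu) : C) <> 0).
  { intros E. injection E. lra. }
  apply Rle_trans with (Cmod (ipow nu 8 t)).
  { apply Rle_trans with (2 := Rmax_Cmod _). apply Rmax_r. }
  unfold ipow. rewrite Cmod_pow, Cmod_inv, Cmod_pair by exact Hz.
  rewrite pow_inv. replace 8%nat with (2 * 4)%nat by reflexivity.
  rewrite pow_mult, pow2_sqrt by lra. right; reflexivity.
Qed.

Lemma is_derive_theta (nu t : R) : 0 < nu ->
  is_derive (theta nu) t (Im (ipow nu 1 t)).
Proof.
  intros Hnu. pose proof (sqr_sum_pos nu t Hnu) as Hp.
  unfold theta, ipow; simpl. auto_derive; [trivial|]. simpl in Hp.
  field. repeat split; try lra; intros E; lra.
Qed.

(** The imaginary part of Stirling's approximation
    [(z - 1/2) Log z - z + 1/(12 z) - 1/(360 z^3) + 1/(1260 z^5)] to [log Gamma z], at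
    [z = t + i nu]. *)
Definition stirling_im (nu t : R) : R :=
  (t - 1 / 2) * theta nu t + nu * (ln (t ^ 2 + nu ^ 2) / 2) - nu
  + (1 / 12 * Im (ipow nu 1 t) - 1 / 360 * Im (ipow nu 3 t) + 1 / 1260 * Im (ipow nu 5 t)).

(** If [stirling_im] were exactly the argument of [Gamma], the functional equation
    [Gamma (z + 1) = z Gamma z] would make this vanish. *)
Definition stirling_defect (nu t : R) : R :=
  stirling_im nu (t + 1) - stirling_im nu t - theta nu t.

(** One step of the Euler-Maclaurin formula for [Log], without integrals.  With
    [b_k = B_k / k!] (Bernoulli polynomials, [b_k' = b_(k-1)]) the derivative in [s] of
    [F (z+s) - sum_(k=1..8) (-1)^(k-1) b_k(s) f^(k-1)(z+s)], where [f = Log] and [F' = f],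
    telescopes to [b_8(s) f^(8)(z+s)].  The values of [b_k] at [0] and [1] make the increment of
    this function over [[0, 1]] equal to the defect, and the mean value theorem bounds the
    imaginary part of that increment by the derivative, which is [O(z ^ -8)].  In [b_8] the
    constant term is dropped: this keeps [b_8' = b_7] and removes the boundary term in [f^(7)]. *)
Lemma stirling_defect_le (nu t : R) : 0 < nu -> 0 <= t ->
  Rabs (stirling_defect nu t) <= 5040 / (t ^ 2 + nu ^ 2) ^ 4.
Proof.
  intros Hnu Ht.
  set (psi := fun s : R =>
    ((t + s) * theta nu (t + s) + nu * (ln ((t + s) ^ 2 + nu ^ 2) / 2)) +
    ((- (s - 1 / 2)) * theta nu (t + s) +
    (((s ^ 2 - s + 1 / 6) / 2) * Im (ipow nu 1 (t + s)) +
    (((s ^ 3 - 3 / 2 * s ^ 2 + 1 / 2 * s) / 6) * Im (ipow nu 2 (t + s)) +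
    ((2 * (s ^ 4 - 2 * s ^ 3 + s ^ 2 - 1 / 30) / 24) * Im (ipow nu 3 (t + s)) +
    ((6 * (s ^ 5 - 5 / 2 * s ^ 4 + 5 / 3 * s ^ 3 - s / 6) / 120) * Im (ipow nu 4 (t + s)) +
    ((24 * (s ^ 6 - 3 * s ^ 5 + 5 / 2 * s ^ 4 - s ^ 2 / 2 + 1 / 42) / 720) * Im (ipow nu 5 (t + s)) +
    ((120 * (s ^ 7 - 7 / 2 * s ^ 6 + 7 / 2 * s ^ 5 - 7 / 6 * s ^ 3 + s / 6) / 5040) * Im (ipow nu 6 (t + s)) +
    (720 * (s ^ 8 - 4 * s ^ 7 + 14 / 3 * s ^ 6 - 7 / 3 * s ^ 4 + 2 / 3 * s ^ 2) / 40320) * Im (ipow nu 7 (t + s)))))))))).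
  assert (Hd : forall s, is_derive psi s
    (- 5040 * ((s ^ 8 - 4 * s ^ 7 + 14 / 3 * s ^ 6 - 7 / 3 * s ^ 4 + 2 / 3 * s ^ 2) / 40320)
     * Im (ipow nu 8 (t + s)))).
  { intros s.
    assert (Hsh : forall (f : R -> R) l, is_derive f (t + s) l ->
       is_derive (fun s => f (t + s)) s l).
    { intros f l Hf. evar_last.
      { apply (is_derive_comp f (fun s => t + s)). exact Hf. auto_derive; [trivial|reflexivity]. }
      unfold scal; simpl; unfold mult; simpl; ring. }
    pose proof (Hsh _ _ (is_derive_theta nu (t + s) Hnu)) as Hth.
    assert (Hw : forall k, is_derive (fun s => Im (ipow nu k (t + s))) s
       (- INR k * Im (ipow nu (S k) (t + s)))).
    { intros k. exact (Hsh _ _ (proj2 (is_derive_ipow nu (t + s) k Hnu))). }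
    unfold psi. evar_last.
    { apply is_derive_add.
      { apply is_derive_add.
        - apply is_derive_mul; [|exact Hth]. auto_derive; [trivial|reflexivity].
        - instantiate (1 := nu * ((t + s) / ((t + s) ^ 2 + nu ^ 2))).
          pose proof (sqr_sum_pos nu (t + s) Hnu).
          auto_derive; [simpl in *; lra|]. field. simpl in *; lra. }
      apply is_derive_add.
      { apply is_derive_mul; [|exact Hth]. auto_derive; [trivial|reflexivity]. }
      do 6 (apply is_derive_add; [apply is_derive_mul; [auto_derive; [trivial|reflexivity] | apply Hw]|]).
      apply is_derive_mul; [auto_derive; [trivial|reflexivity] | apply Hw]. }
    assert (E1 : (t + s) * Im (ipow nu 1 (t + s)) + nu * ((t + s) / ((t + s) ^ 2 + nu ^ 2)) = 0).
    { pose proof (sqr_sum_pos nu (t + s) Hnu). unfold ipow; simpl. simpl in *. field. lra. }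
    cbv beta.
    generalize dependent (nu * ((t + s) / ((t + s) ^ 2 + nu ^ 2))). intros L E1.
    replace L with (- ((t + s) * Im (ipow nu 1 (t + s)))) by lra.
    simpl INR. simpl Nat.pred. field. }
  destruct (MVT_is_derive psi _ 0 1 ltac:(lra) (fun c _ => Hd c)) as [c [Hc Hc1]].
  assert (E : stirling_defect nu t = psi 1 - psi 0).
  { unfold stirling_defect, psi, stirling_im. rewrite Rplus_0_r.
    simpl (0 ^ _). simpl (1 ^ _). field. }
  rewrite E, Hc, Rminus_0_r, Rmult_1_r, Rabs_mult.
  unfold Rdiv at 1. apply Rmult_le_compat; try apply Rabs_pos.
  - assert (0 <= c ^ 2 <= 1) by (split; nra).
    assert (0 <= c ^ 4 <= 1) by (replace (c ^ 4) with (c ^ 2 * c ^ 2) by ring; split; nra).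
    assert (0 <= c ^ 6 <= 1) by (replace (c ^ 6) with (c ^ 2 * c ^ 4) by ring; split; nra).
    assert (0 <= c ^ 7 <= 1) by (replace (c ^ 7) with (c * c ^ 6) by ring; split; nra).
    assert (0 <= c ^ 8 <= 1) by (replace (c ^ 8) with (c ^ 2 * c ^ 6) by ring; split; nra).
    apply Rabs_le. lra.
  - apply Rle_trans with (1 := Im_ipow8_le nu (t + c) Hnu).
    apply Rinv_le_contravar; [apply pow_lt, sqr_sum_pos, Hnu|].
    apply pow_incr. split; [left; apply sqr_sum_pos, Hnu|nra].
Qed.

(** * The argument of Gamma (1 + i nu) *)

(** Comparison with the integral of [1 / (u^2 + nu^2)], which is an arctangent. *)
Lemma sum_inv_sqr_sum_le (nu : R) (n : nat) : 1 <= nu ->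
  sum_f_R0 (fun j => / (INR j ^ 2 + nu ^ 2)) n <= 3 / nu.
Proof.
  intros Hnu.
  assert (H : sum_f_R0 (fun j => / (INR j ^ 2 + nu ^ 2)) n
              <= / nu ^ 2 + atan (INR n / nu) / nu).
  { induction n as [|n IH].
    - simpl sum_f_R0. simpl INR. unfold Rdiv. rewrite (Rmult_0_l (/ nu)), atan_0.
      right. field. nra.
    - rewrite tech5. rewrite S_INR. set (x := INR n) in *.
      assert (Hx : 0 <= x) by apply pos_INR.
      destruct (MVT_is_derive (fun u => atan (u / nu) / nu) (fun u => / (u ^ 2 + nu ^ 2)) x (x + 1))
        as [c [Hc Hc1]]; [lra| |].
      { intros c Hc. pose proof (sqr_sum_pos nu c ltac:(lra)) as Hp. simpl in Hp.
        auto_derive; [trivial|]. simpl. field. repeat split; try lra; intros E; lra. }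
      assert (/ ((x + 1) ^ 2 + nu ^ 2) <= / (c ^ 2 + nu ^ 2)).
      { apply Rinv_le_contravar; [apply sqr_sum_pos; lra|]. nra. }
      lra. }
  apply Rle_trans with (1 := H).
  assert (Ha : atan (INR n / nu) <= 2).
  { pose proof (atan_bound (INR n / nu)). pose proof PI_4. lra. }
  assert (/ nu ^ 2 <= / nu) by (apply Rinv_le_contravar; nra).
  assert (atan (INR n / nu) / nu <= 2 / nu).
  { unfold Rdiv. apply Rmult_le_compat_r; [left; apply Rinv_0_lt_compat; lra|exact Ha]. }
  lra.
Qed.

Lemma ex_series_bounded (a : nat -> R) (M : R) :
  (forall n, 0 <= a n) -> (forall n, sum_f_R0 a n <= M) -> ex_series a.
Proof.
  intros Ha HM.
  destruct (ex_finite_lim_seq_incr (sum_n a) M) as [l Hl].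
  - intros n. rewrite sum_Sn. unfold plus; simpl. specialize (Ha (S n)). lra.
  - intros n. rewrite sum_n_Reals. apply HM.
  - exists l. exact Hl.
Qed.

(** Each defect is at most [5040 / nu^6] times [1 / (j^2 + nu^2)], and the latter sum is at most
    [3 / nu]. *)
Lemma stirling_defect_series (nu : R) : 1 <= nu ->
  ex_series (fun j => Rabs (stirling_defect nu (INR j))) /\
  Rabs (Series (fun j => stirling_defect nu (INR j))) <= 15120 / nu ^ 7.
Proof.
  intros Hnu.
  set (a := fun j => Rabs (stirling_defect nu (INR j))).
  assert (Hb : forall j, a j <= (5040 / nu ^ 6) * / (INR j ^ 2 + nu ^ 2)).
  { intros j. apply Rle_trans with (1 := stirling_defect_le nu (INR j) ltac:(lra) (pos_INR j)).
    pose proof (sqr_sum_pos nu (INR j) ltac:(lra)) as Hp.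
    assert (0 < nu ^ 6) by (apply pow_lt; lra).
    replace (5040 / nu ^ 6 * / (INR j ^ 2 + nu ^ 2))
      with (5040 * / (nu ^ 6 * (INR j ^ 2 + nu ^ 2))).
    2: { field. split; lra. }
    unfold Rdiv. apply Rmult_le_compat_l; [lra|].
    apply Rinv_le_contravar; [apply Rmult_lt_0_compat; auto|].
    replace ((INR j ^ 2 + nu ^ 2) ^ 4) with ((INR j ^ 2 + nu ^ 2) ^ 3 * (INR j ^ 2 + nu ^ 2)) by ring.
    apply Rmult_le_compat_r; [lra|].
    replace (nu ^ 6) with ((nu ^ 2) ^ 3) by ring. apply pow_incr.
    pose proof (pow2_ge_0 (INR j)). nra. }
  assert (Hs : forall n, sum_f_R0 a n <= 15120 / nu ^ 7).
  { intros n.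
    apply Rle_trans with (sum_f_R0 (fun j => (5040 / nu ^ 6) * / (INR j ^ 2 + nu ^ 2)) n).
    { apply sum_Rle. intros j _. apply Hb. }
    replace (sum_f_R0 (fun j => 5040 / nu ^ 6 * / (INR j ^ 2 + nu ^ 2)) n)
      with (5040 / nu ^ 6 * sum_f_R0 (fun j => / (INR j ^ 2 + nu ^ 2)) n).
    2: { rewrite scal_sum. apply sum_eq. intros; ring. }
    apply Rle_trans with (5040 / nu ^ 6 * (3 / nu)).
    { apply Rmult_le_compat_l; [|now apply sum_inv_sqr_sum_le].
      left. apply Rdiv_lt_0_compat; [lra|apply pow_lt; lra]. }
    right. field. lra. }
  assert (He : ex_series a).
  { apply ex_series_bounded with (15120 / nu ^ 7); [intros; apply Rabs_pos|exact Hs]. }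
  split; [exact He|].
  apply Rle_trans with (1 := Series_Rabs _ He).
  apply Series_correct in He.
  apply (is_lim_seq_le (sum_n a) (fun _ => 15120 / nu ^ 7) (Series a) (15120 / nu ^ 7)).
  - intros n. rewrite sum_n_Reals. apply Hs.
  - exact He.
  - apply is_lim_seq_const.
Qed.

(** The argument of the [n]th term of Euler's limit for [Gamma (1 + i nu)]. *)
Definition gamma_phase_seq (nu : R) (n : nat) : R :=
  nu * ln (INR n) - sum_f_R0 (fun j => theta nu (INR j + 1)) n.

Definition gamma_phase (nu : R) : R := real (Lim_seq (gamma_phase_seq nu)).

Lemma atan_le_id (y : R) : 0 <= y -> y - y ^ 3 <= atan y <= y.
Proof.
  intros Hy. destruct (Req_dec y 0) as [->|Hy0]; [rewrite atan_0; lra|].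
  destruct (MVT_is_derive atan (fun u => / (1 + u ^ 2)) 0 y) as [c [Hc Hc1]]; [lra| |].
  { intros c _. apply is_derive_Reals.
    apply derivable_pt_lim_atan. }
  rewrite atan_0, !Rminus_0_r in Hc. rewrite Hc.
  assert (H1 : / (1 + c ^ 2) <= 1).
  { rewrite <- Rinv_1. apply Rinv_le_contravar; nra. }
  assert (H2 : 1 - y ^ 2 <= / (1 + c ^ 2)).
  { apply Rmult_le_reg_r with (1 + c ^ 2); [nra|]. rewrite Rinv_l by nra.
    assert (c ^ 2 <= y ^ 2) by nra. nra. }
  split; nra.
Qed.

Lemma theta_bounds (nu t : R) : 0 < nu -> 0 < t ->
  nu / t - (nu / t) ^ 3 <= theta nu t <= nu / t.
Proof.
  intros Hnu Ht. assert (H : theta nu t = atan (nu / t)).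
  { unfold theta. replace (nu / t) with (/ (t / nu)) by (field; lra).
    rewrite atan_inv; [reflexivity|]. apply Rdiv_lt_0_compat; lra. }
  rewrite H. apply atan_le_id. left. apply Rdiv_lt_0_compat; lra.
Qed.

Lemma Im_ipow_le (nu t : R) (k : nat) : 0 < nu -> 1 <= t -> (1 <= k)%nat ->
  Rabs (Im (ipow nu k t)) <= / t.
Proof.
  intros Hnu Ht Hk.
  assert (Hz : ((t, nu) : C) <> 0) by (intros E; injection E; lra).
  apply Rle_trans with (Cmod (ipow nu k t)).
  { apply Rle_trans with (2 := Rmax_Cmod _). apply Rmax_r. }
  unfold ipow. rewrite Cmod_pow, Cmod_inv, Cmod_pair by exact Hz.
  assert (Hs : t <= sqrt (t ^ 2 + nu ^ 2)).
  { rewrite <- (sqrt_pow2 t) at 1 by lra. apply sqrt_le_1; nra. }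
  assert (Hi : 0 < / sqrt (t ^ 2 + nu ^ 2) <= / t).
  { split; [apply Rinv_0_lt_compat; lra|]. apply Rinv_le_contravar; lra. }
  assert (/ t <= 1) by (rewrite <- Rinv_1; apply Rinv_le_contravar; lra).
  destruct k as [|k]; [lia|]. rewrite <- tech_pow_Rmult.
  rewrite <- (Rmult_1_r (/ t)). apply Rmult_le_compat; try lra.
  - apply pow_le; lra.
  - rewrite <- (pow1 k). apply pow_incr. lra.
Qed.

Lemma ln_le_sub (y : R) : 0 < y -> ln y <= y - 1.
Proof.
  intros Hy. pose proof (exp_ineq1_le (ln y)). rewrite exp_ln in H by lra. lra.
Qed.

Lemma ln_log_modulus_le (nu x d : R) : 1 <= x -> 0 <= d ->
  0 <= ln ((x + d) ^ 2 + nu ^ 2) / 2 - ln x <= (2 * d + d ^ 2 + nu ^ 2) / x.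
Proof.
  intros Hx Hd.
  assert (E : ln ((x + d) ^ 2 + nu ^ 2) / 2 - ln x
              = ln (((x + d) ^ 2 + nu ^ 2) / x ^ 2) / 2).
  { rewrite ln_div; [|nra|nra]. simpl (x ^ 2). rewrite Rmult_1_r, ln_mult by lra. field. }
  rewrite E.
  assert (H1 : 1 <= ((x + d) ^ 2 + nu ^ 2) / x ^ 2).
  { apply Rmult_le_reg_r with (x ^ 2); [nra|]. unfold Rdiv.
    rewrite Rmult_assoc, Rinv_l by nra. nra. }
  split.
  - assert (0 <= ln (((x + d) ^ 2 + nu ^ 2) / x ^ 2)).
    { rewrite <- ln_1. apply ln_le; lra. }
    lra.
  - apply Rle_trans with (((x + d) ^ 2 + nu ^ 2) / x ^ 2 - 1).
    { pose proof (ln_le_sub (((x + d) ^ 2 + nu ^ 2) / x ^ 2) ltac:(lra)). lra. }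
    replace (((x + d) ^ 2 + nu ^ 2) / x ^ 2 - 1) with ((2 * d + (d ^ 2 + nu ^ 2) / x) / x) by (field; lra).
    apply Rmult_le_compat_r; [left; apply Rinv_0_lt_compat; lra|].
    assert ((d ^ 2 + nu ^ 2) / x <= d ^ 2 + nu ^ 2); [|lra].
    apply Rmult_le_reg_r with x; [lra|]. unfold Rdiv. rewrite Rmult_assoc, Rinv_l by lra.
    pose proof (pow2_ge_0 d). pose proof (pow2_ge_0 nu). nra.
Qed.

Lemma is_lim_seq_le_inv (u : nat -> R) (K : R) :
  (forall n, (1 <= n)%nat -> Rabs (u n) <= K / INR n) -> is_lim_seq u 0.
Proof.
  intros H. apply is_lim_seq_abs_0.
  apply is_lim_seq_le_le_loc with (fun _ => 0) (fun n => K * / INR n).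
  - exists 1%nat. intros n Hn. split; [apply Rabs_pos|]. now apply H.
  - apply is_lim_seq_const.
  - replace 0 with (K * 0) at 1 by ring.
    apply (is_lim_seq_scal_l (fun n => / INR n) K 0).
    apply (is_lim_seq_inv INR p_infty); [apply is_lim_seq_INR | discriminate].
Qed.

(** Stirling's approximation is exact at infinity: here [(t - 1/2) theta] tends to [nu], which
    cancels the term [- nu], and [ln |t + i nu| - ln n] tends to [0]. *)
Lemma stirling_im_lim (nu : R) : 0 < nu ->
  is_lim_seq (fun n => nu * ln (INR n) - stirling_im nu (INR n + 2)) 0.
Proof.
  intros Hnu.
  apply is_lim_seq_le_inv with (nu * (8 + nu ^ 2) + nu ^ 3 + nu + 1).
  intros n Hn. assert (Hx : 1 <= INR n) by (now apply (le_INR 1)).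
  set (x := INR n) in *. unfold stirling_im.
  destruct (theta_bounds nu (x + 2) Hnu ltac:(lra)) as [T1 T2].
  pose proof (ln_log_modulus_le nu x 2 Hx ltac:(lra)) as [L1 L2].
  pose proof (Im_ipow_le nu (x + 2) 1 Hnu ltac:(lra) ltac:(lia)) as I1.
  pose proof (Im_ipow_le nu (x + 2) 3 Hnu ltac:(lra) ltac:(lia)) as I3.
  pose proof (Im_ipow_le nu (x + 2) 5 Hnu ltac:(lra) ltac:(lia)) as I5.
  assert (Hi : 0 < / (x + 2) <= / x).
  { split; [apply Rinv_0_lt_compat; lra|apply Rinv_le_contravar; lra]. }
  set (y := / (x + 2)) in *.
  replace (nu / (x + 2)) with (nu * y) in * by reflexivity.
  assert (Hxy : (x + 2) * y = 1) by (unfold y; field; lra).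
  apply Rabs_le_between in I1. apply Rabs_le_between in I3. apply Rabs_le_between in I5.
  set (th := theta nu (x + 2)) in *.
  assert (A1 : - (nu * y / 2) - nu ^ 3 * y <= (x + 2 - 1 / 2) * th - nu <= 0).
  { assert (0 <= y <= 1/2) by (split; [lra|]; nra).
    split.
    - assert ((x + 2 - 1 / 2) * (nu * y - (nu * y) ^ 3) <= (x + 2 - 1 / 2) * th) by (apply Rmult_le_compat_l; lra).
      replace ((x + 2 - 1 / 2) * (nu * y - (nu * y) ^ 3)) with
        (nu * ((x + 2) * y) - nu * y / 2 - nu ^ 3 * y ^ 2 * ((x + 2) * y) + (nu * y)^3 / 2) in H0 by field.
      rewrite Hxy in H0.
      assert (0 <= (nu * y) ^ 3) by (apply pow_le; nra).
      assert (0 <= nu ^ 3) by (apply pow_le; lra).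
      assert (nu ^ 3 * y ^ 2 <= nu ^ 3 * y) by (apply Rmult_le_compat_l; [lra|nra]).
      lra.
    - assert ((x + 2 - 1 / 2) * th <= (x + 2 - 1 / 2) * (nu * y)) by (apply Rmult_le_compat_l; lra).
      replace ((x + 2 - 1 / 2) * (nu * y)) with (nu * ((x + 2) * y) - nu * y / 2) in H0 by field.
      rewrite Hxy in H0. assert (0 < nu * y) by nra. lra. }
  set (LL := ln ((x + 2) ^ 2 + nu ^ 2) / 2) in *.
  assert (A2 : 0 <= nu * (LL - ln x) <= nu * (8 + nu ^ 2) * / x).
  { split; [nra|]. rewrite Rmult_assoc. apply Rmult_le_compat_l; [lra|].
    replace ((8 + nu ^ 2) * / x) with ((2 * 2 + 2 ^ 2 + nu ^ 2) / x) by (unfold Rdiv; ring). exact L2. }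
  assert (A3 : nu ^ 3 * y <= nu ^ 3 * / x) by (apply Rmult_le_compat_l; [apply pow_le; lra|lra]).
  assert (A4 : nu * y <= nu * / x) by (apply Rmult_le_compat_l; lra).
  assert (0 <= nu * y) by nra.
  assert (0 <= nu ^ 3 * y) by (apply Rmult_le_pos; [apply pow_le; lra|lra]).
  unfold Rdiv in *. apply Rabs_le.
  replace (nu * (8 + nu ^ 2) + nu ^ 3 + nu + 1) with ((nu * (8 + nu ^ 2)) + (nu ^ 3 + nu + 1)) by ring.
  rewrite !Rmult_plus_distr_r.
  split; lra.
Qed.

(** Telescoping from [t = 0] rather than from [t = 1] gives an error term in powers of [1 / nu]
    directly; the price is the argument [PI / 2] of [i nu]. *)
Lemma sum_theta (nu : R) (n : nat) : 0 < nu ->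
  sum_f_R0 (fun j => theta nu (INR j + 1)) n =
  stirling_im nu (INR n + 2) - stirling_im nu 0 - PI / 2
  - sum_f_R0 (fun j => stirling_defect nu (INR j)) (S n).
Proof.
  intros Hnu. induction n as [|n IH].
  - simpl sum_f_R0. simpl INR. unfold stirling_defect.
    assert (theta nu 0 = PI / 2) by (unfold theta, Rdiv; rewrite Rmult_0_l, atan_0; ring).
    rewrite H, !Rplus_0_l. replace (1 + 1) with 2 by ring. ring.
  - rewrite tech5, IH, (tech5 _ (S n)). rewrite !S_INR. unfold stirling_defect.
    replace (INR n + 1 + 1) with (INR n + 2) by ring.
    replace (INR n + 1 + 2) with (INR n + 2 + 1) by ring. ring.
Qed.

Lemma stirling_im_0 (nu : R) : 0 < nu ->
  stirling_im nu 0 + PI / 2 =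
  PI / 4 + nu * ln nu - nu - 1 / (12 * nu) - 1 / (360 * nu ^ 3) - 1 / (1260 * nu ^ 5).
Proof.
  intros Hnu. unfold stirling_im.
  assert (theta nu 0 = PI / 2) by (unfold theta, Rdiv; rewrite Rmult_0_l, atan_0; ring).
  rewrite H. replace (0 ^ 2 + nu ^ 2) with (nu * nu) by ring. rewrite ln_mult by lra.
  unfold ipow. simpl. field. nra.
Qed.

(** Stirling's formula for the argument of [Gamma (1 + i nu)].  The error is the sum of all
    defects, so that the existence of the limit and its expansion come together. *)
Lemma gamma_phase_lim (nu : R) : 1 <= nu ->
  is_lim_seq (gamma_phase_seq nu) (gamma_phase nu) /\
  Rabs (gamma_phase nu - (PI / 4 + nu * ln nu - nu - 1 / (12 * nu) - 1 / (360 * nu ^ 3)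
        - 1 / (1260 * nu ^ 5))) <= 15120 / nu ^ 7.
Proof.
  intros Hnu. destruct (stirling_defect_series nu Hnu) as [Hex Hle].
  set (S0 := Series (fun j => stirling_defect nu (INR j))) in *.
  assert (HS : is_lim_seq (fun n => sum_f_R0 (fun j => stirling_defect nu (INR j)) (S n)) S0).
  { apply (is_lim_seq_incr_1 (fun n => sum_f_R0 (fun j => stirling_defect nu (INR j)) n)).
    apply is_lim_seq_ext with (sum_n (fun j => stirling_defect nu (INR j))).
    { intros n. apply sum_n_Reals. }
    apply Series_correct. now apply ex_series_Rabs. }
  assert (HL : is_lim_seq (gamma_phase_seq nu) (0 + (stirling_im nu 0 + PI / 2) + S0)).
  { apply is_lim_seq_ext with (fun n => (nu * ln (INR n) - stirling_im nu (INR n + 2))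
      + (stirling_im nu 0 + PI / 2) + sum_f_R0 (fun j => stirling_defect nu (INR j)) (S n)).
    { intros n. unfold gamma_phase_seq. rewrite sum_theta by lra. ring. }
    apply is_lim_seq_plus'; [|exact HS].
    apply is_lim_seq_plus'; [apply stirling_im_lim; lra|apply is_lim_seq_const]. }
  assert (HE : gamma_phase nu = 0 + (stirling_im nu 0 + PI / 2) + S0).
  { unfold gamma_phase. now rewrite (is_lim_seq_unique _ _ HL). }
  rewrite HE. split; [exact HL|].
  rewrite stirling_im_0 by lra.
  match goal with |- Rabs ?e <= _ => replace e with S0 by ring end. exact Hle.
Qed.

(** The sum is the [nu]-derivative of the arguments in Euler's limit.  Each term differs from the
    increment of [ln |u + i c|] by at most [1 / (j^2 + c^2)]. *)
Lemma sum_log_derivative (c : R) (n : nat) : 1 <= c ->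
  Rabs (sum_f_R0 (fun j => (INR j + 1) / ((INR j + 1) ^ 2 + c ^ 2)) n
        - (ln ((INR n + 1) ^ 2 + c ^ 2) / 2 - ln c)) <= 3 / c.
Proof.
  intros Hc.
  apply Rle_trans with (2 := sum_inv_sqr_sum_le c n Hc).
  assert (Hstep : forall j, Rabs ((INR j + 1) / ((INR j + 1) ^ 2 + c ^ 2)
     - (ln ((INR j + 1) ^ 2 + c ^ 2) / 2 - ln (INR j ^ 2 + c ^ 2) / 2)) <= / (INR j ^ 2 + c ^ 2)).
  { intros j. set (x := INR j). assert (Hx : 0 <= x) by apply pos_INR.
    destruct (MVT_is_derive (fun u => ln (u ^ 2 + c ^ 2) / 2) (fun u => u / (u ^ 2 + c ^ 2)) x (x + 1))
      as [d [Hd Hd1]]; [lra| |].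
    { intros d _. pose proof (sqr_sum_pos c d ltac:(lra)) as Hp. simpl in Hp.
      auto_derive; [simpl; lra|]. simpl. field. lra. }
    rewrite Hd. replace (d / (d ^ 2 + c ^ 2) * (x + 1 - x)) with (d / (d ^ 2 + c ^ 2)) by ring.
    pose proof (sqr_sum_pos c d ltac:(lra)) as P1.
    pose proof (sqr_sum_pos c x ltac:(lra)) as P2.
    pose proof (sqr_sum_pos c (x + 1) ltac:(lra)) as P3.
    replace ((x + 1) / ((x + 1) ^ 2 + c ^ 2) - d / (d ^ 2 + c ^ 2)) with
      (((x + 1 - d) * (c ^ 2 - d * (x + 1))) * / ((x + 1) ^ 2 + c ^ 2) * / (d ^ 2 + c ^ 2))
      by (field; lra).
    rewrite !Rabs_mult.
    rewrite (Rabs_pos_eq (/ ((x + 1) ^ 2 + c ^ 2))) by (left; now apply Rinv_0_lt_compat).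
    rewrite (Rabs_pos_eq (/ (d ^ 2 + c ^ 2))) by (left; now apply Rinv_0_lt_compat).
    rewrite <- (Rmult_1_l (/ (x ^ 2 + c ^ 2))).
    apply Rmult_le_compat.
    - repeat apply Rmult_le_pos; try apply Rabs_pos. left; now apply Rinv_0_lt_compat.
    - left; now apply Rinv_0_lt_compat.
    - apply Rmult_le_reg_r with ((x + 1) ^ 2 + c ^ 2); [exact P3|].
      rewrite Rmult_assoc, Rinv_l, Rmult_1_r, Rmult_1_l by lra.
      rewrite (Rabs_pos_eq (x + 1 - d)) by lra.
      assert (Rabs (c ^ 2 - d * (x + 1)) <= (x + 1) ^ 2 + c ^ 2) by (apply Rabs_le; split; nra).
      pose proof (Rabs_pos (c ^ 2 - d * (x + 1))). nra.
    - apply Rinv_le_contravar; [exact P2|nra]. }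
  induction n as [|n IH].
  - simpl sum_f_R0. specialize (Hstep 0%nat). simpl INR in *.
    replace (ln (0 ^ 2 + c ^ 2) / 2) with (ln c) in Hstep; [exact Hstep|].
    replace (0 ^ 2 + c ^ 2) with (c * c) by ring. rewrite ln_mult by lra. field.
  - rewrite !tech5. specialize (Hstep (S n)). rewrite S_INR in *.
    match goal with |- Rabs (?a + ?b - (?p - ?q)) <= _ =>
      replace (a + b - (p - q)) with ((a - (ln ((INR n + 1) ^ 2 + c ^ 2) / 2 - q)) +
        (b - (p - ln ((INR n + 1) ^ 2 + c ^ 2) / 2))) by ring end.
    apply Rle_trans with (1 := Rabs_triang _ _). lra.
Qed.

Lemma is_derive_gamma_phase_seq (n : nat) (nu : R) : 0 < nu ->
  is_derive (fun v => gamma_phase_seq v n) nu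
    (ln (INR n) - sum_f_R0 (fun j => (INR j + 1) / ((INR j + 1) ^ 2 + nu ^ 2)) n).
Proof.
  intros Hnu. unfold gamma_phase_seq.
  assert (Hs : is_derive (fun v => sum_f_R0 (fun j => theta v (INR j + 1)) n) nu
     (sum_f_R0 (fun j => (INR j + 1) / ((INR j + 1) ^ 2 + nu ^ 2)) n)).
  { assert (Ht : forall x, is_derive (fun v => theta v x) nu (x / (x ^ 2 + nu ^ 2))).
    { intros x. pose proof (sqr_sum_pos nu x Hnu) as Hp. simpl in Hp.
      unfold theta. auto_derive; [lra|]. simpl. field. repeat split; try lra; intros E; lra. }
    induction n as [|n IH]; simpl sum_f_R0; [apply Ht|].
    apply is_derive_add; [exact IH|apply Ht]. }
  evar_last.
  - apply is_derive_add; [|apply (@is_derive_opp R_AbsRing R_NormedModule); exact Hs].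
    apply is_derive_mul; [apply (@is_derive_id R_AbsRing)|apply (@is_derive_const R_AbsRing R_NormedModule)].
  - unfold opp, one, zero; simpl. ring.
Qed.

(** The increments are taken in Euler's limit, where the mean value theorem applies for each [n],
    and only then is [n] sent to infinity; so the limit is never differentiated.  A slope
    like [ln nu] makes the phase of [J] monotone, since the power series contributes a Lipschitz
    function. *)
Lemma gamma_phase_increment (a b : R) : 1 <= a -> a < b ->
  (b - a) * (ln a - 3) <= gamma_phase b - gamma_phase a <= (b - a) * (ln b + 3).
Proof.
  intros Ha Hab.
  assert (Hlim : is_lim_seq (fun n => gamma_phase_seq b n - gamma_phase_seq a n)
      (gamma_phase b - gamma_phase a)).
  { apply is_lim_seq_minus'; apply gamma_phase_lim; lra. }
  assert (Hdiff : forall n, (1 <= n)%nat ->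
    (b - a) * (ln a - 3 - (3 + b ^ 2) / INR n) <= gamma_phase_seq b n - gamma_phase_seq a n
      <= (b - a) * (ln b + 3)).
  { intros n Hn. assert (Hx : 1 <= INR n) by (now apply (le_INR 1)).
    destruct (MVT_is_derive (fun v => gamma_phase_seq v n) _ a b Hab
       (fun c Hc => is_derive_gamma_phase_seq n c ltac:(lra))) as [c [Hc Hc1]].
    rewrite Hc, (Rmult_comm _ (b - a)).
    pose proof (sum_log_derivative c n ltac:(lra)) as Hs.
    apply Rabs_le_between in Hs.
    pose proof (ln_log_modulus_le c (INR n) 1 Hx ltac:(lra)) as [L1 L2].
    assert (3 / c <= 3).
    { apply Rmult_le_reg_r with c; [lra|]. unfold Rdiv. rewrite Rmult_assoc, Rinv_l by lra. lra. }
    assert (ln a <= ln c) by (apply ln_le; lra).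
    assert (ln c <= ln b) by (apply ln_le; lra).
    assert ((2 * 1 + 1 ^ 2 + c ^ 2) / INR n <= (3 + b ^ 2) / INR n).
    { apply Rmult_le_compat_r; [left; apply Rinv_0_lt_compat; lra|]. nra. }
    split; apply Rmult_le_compat_l; lra. }
  split.
  - apply (is_lim_seq_le_loc (fun n => (b - a) * (ln a - 3 - (3 + b ^ 2) / INR n))
      (fun n => gamma_phase_seq b n - gamma_phase_seq a n)
      ((b - a) * (ln a - 3)) (gamma_phase b - gamma_phase a)); [|  |exact Hlim].
    + exists 1%nat. intros n Hn. apply Hdiff. exact Hn.
    + apply (is_lim_seq_scal_l _ (b - a) (ln a - 3)).
      replace (ln a - 3) with (ln a - 3 - 0) at 1 by ring.
      apply is_lim_seq_minus'; [apply is_lim_seq_const|].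
      apply is_lim_seq_le_inv with (3 + b ^ 2). intros n Hn.
      assert (Hx : 1 <= INR n) by (now apply (le_INR 1)).
      rewrite Rabs_pos_eq; [lra|]. apply Rmult_le_pos; [nra|left; apply Rinv_0_lt_compat; lra].
  - apply (is_lim_seq_le_loc (fun n => gamma_phase_seq b n - gamma_phase_seq a n)
      (fun _ => (b - a) * (ln b + 3)) (gamma_phase b - gamma_phase a) ((b - a) * (ln b + 3)));
      [|exact Hlim|apply is_lim_seq_const].
    exists 1%nat. intros n Hn. apply Hdiff. exact Hn.
Qed.

(** * Euler's limit in polar form *)

Definition cis (a : R) : C := (cos a, sin a).

Lemma cis_plus (a b : R) : cis (a + b) = (cis a * cis b)%C.
Proof.
  unfold cis, Cmult; simpl. rewrite cos_plus, sin_plus.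
  apply injective_projections; simpl; ring.
Qed.

Lemma cis_0 : cis 0 = 1.
Proof. unfold cis. now rewrite cos_0, sin_0. Qed.

Lemma cis_opp_mult (a : R) : (cis a * cis (- a))%C = 1.
Proof. rewrite <- cis_plus, Rplus_opp_r. apply cis_0. Qed.

Lemma cis_neq0 (a : R) : cis a <> 0.
Proof.
  intros E. pose proof (cis_opp_mult a) as H. rewrite E, Cmult_0_l in H.
  injection H. lra.
Qed.

Lemma cis_inv (a : R) : (/ cis a)%C = cis (- a).
Proof.
  rewrite <- (Cmult_1_l (/ cis a)), <- (cis_opp_mult a), (Cmult_comm (cis a)), <- Cmult_assoc.
  rewrite Cinv_r by apply cis_neq0. apply Cmult_1_r.
Qed.

Lemma polar_atan (u v : R) : 0 < u ->
  ((u, v) : C) = (RtoC (sqrt (u ^ 2 + v ^ 2)) * cis (atan (v / u)))%C.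
Proof.
  intros Hu. unfold cis. rewrite cos_atan, sin_atan.
  assert (Hs : sqrt (1 + Rsqr (v / u)) = sqrt (u ^ 2 + v ^ 2) / u).
  { replace (1 + Rsqr (v / u)) with ((u ^ 2 + v ^ 2) / (u ^ 2)) by (unfold Rsqr; field; lra).
    rewrite sqrt_div by nra. rewrite sqrt_pow2 by lra. reflexivity. }
  assert (0 < sqrt (u ^ 2 + v ^ 2)) by (apply sqrt_lt_R0; nra).
  replace (1 + (v / u) ^ 2) with (1 + Rsqr (v / u)) by (unfold Rsqr; ring).
  rewrite Hs. set (s := sqrt (u ^ 2 + v ^ 2)) in *. clearbody s.
  apply injective_projections; simpl; field; lra.
Qed.

(** [polar_atan] for [nu + i t], reflected in the diagonal. *)
Lemma polar_theta (nu t : R) : 0 < nu ->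
  ((t, nu) : C) = (RtoC (sqrt (t ^ 2 + nu ^ 2)) * cis (theta nu t))%C.
Proof.
  intros Hnu.
  pose proof (polar_atan nu t Hnu) as H.
  unfold theta, cis in *. rewrite cos_shift, sin_shift.
  rewrite (Rplus_comm (t ^ 2)).
  injection H as H1 H2. simpl in H1, H2.
  apply injective_projections; simpl; lra.
Qed.

(** Componentwise convergence, which is what makes [Clim_seq] meaningful. *)
Definition is_Clim (u : nat -> C) (l : C) : Prop :=
  is_lim_seq (fun n => Re (u n)) (Re l) /\ is_lim_seq (fun n => Im (u n)) (Im l).

Lemma is_Clim_unique (u : nat -> C) (l : C) : is_Clim u l -> Clim_seq u = l.
Proof.
  intros [H1 H2]. unfold Clim_seq.
  rewrite (is_lim_seq_unique _ _ H1), (is_lim_seq_unique _ _ H2).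
  symmetry; apply surjective_pairing.
Qed.

Lemma is_Clim_ext_loc (u v : nat -> C) (l : C) :
  eventually (fun n => u n = v n) -> is_Clim u l -> is_Clim v l.
Proof.
  intros E [H1 H2]; split; eapply is_lim_seq_ext_loc; try eassumption;
  revert E; apply filter_imp; intros n En; now rewrite En.
Qed.

Lemma is_Clim_mult (u v : nat -> C) (k l : C) :
  is_Clim u k -> is_Clim v l -> is_Clim (fun n => (u n * v n)%C) (k * l)%C.
Proof.
  intros [U1 U2] [V1 V2]; split.
  - apply is_lim_seq_ext with (fun n => Re (u n) * Re (v n) - Im (u n) * Im (v n)).
    { intros n. now rewrite re_mult. }
    rewrite re_mult. apply is_lim_seq_minus'; now apply is_lim_seq_mult'.
  - apply is_lim_seq_ext with (fun n => Re (u n) * Im (v n) + Im (u n) * Re (v n)).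
    { intros n. now rewrite im_mult. }
    rewrite im_mult. apply is_lim_seq_plus'; now apply is_lim_seq_mult'.
Qed.

Lemma is_Clim_const (l : C) : is_Clim (fun _ => l) l.
Proof. split; apply is_lim_seq_const. Qed.

Lemma Im_le_Cmod (z : C) : Rabs (Im z) <= Cmod z.
Proof. apply Rle_trans with (2 := Rmax_Cmod _). apply Rmax_r. Qed.

Lemma is_Clim_le_inv (u : nat -> C) (l : C) (K : R) :
  (forall n, (1 <= n)%nat -> Cmod (u n - l) <= K / INR n) -> is_Clim u l.
Proof.
  intros H. split.
  - apply is_lim_seq_ext with (fun n => Re (u n - l)%C + Re l).
    { intros n. unfold Cminus. rewrite re_plus, re_opp. ring. }
    replace (Finite (Re l)) with (Finite (0 + Re l)) by (f_equal; ring).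
    apply is_lim_seq_plus'; [|apply is_lim_seq_const].
    apply is_lim_seq_le_inv with K. intros n Hn.
    apply Rle_trans with (2 := H n Hn). apply re_le_Cmod.
  - apply is_lim_seq_ext with (fun n => Im (u n - l)%C + Im l).
    { intros n. unfold Cminus. rewrite im_plus, im_opp. ring. }
    replace (Finite (Im l)) with (Finite (0 + Im l)) by (f_equal; ring).
    apply is_lim_seq_plus'; [|apply is_lim_seq_const].
    apply is_lim_seq_le_inv with K. intros n Hn.
    apply Rle_trans with (2 := H n Hn). apply Im_le_Cmod.
Qed.

Definition gamma_seq (z : C) (n : nat) : C :=
  (INR (fact n) * RCpower (INR n) z / Cshift_prod z n)%C.

Lemma RCpower_plus_1 (n : nat) (z : C) : (1 <= n)%nat ->
  RCpower (INR n) (z + 1) = (INR n * RCpower (INR n) z)%C.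
Proof.
  intros Hn. assert (0 < INR n) by (apply lt_0_INR; lia).
  unfold RCpower, Cexp, Cmult, Cplus, RtoC; simpl.
  replace (ln (INR n) * (fst z + 1) - 0 * (snd z + 0)) with (ln (INR n) + (ln (INR n) * fst z - 0 * snd z)) by ring.
  replace (ln (INR n) * (snd z + 0) + 0 * (fst z + 1)) with (ln (INR n) * snd z + 0 * fst z) by ring.
  rewrite exp_plus, exp_ln by lra. apply injective_projections; simpl; ring.
Qed.

Lemma Cneq_Re (z : C) : 0 < Re z -> z <> 0.
Proof. intros H E. rewrite E in H. simpl in H. lra. Qed.

Lemma Cshift_prod_neq0 (z : C) (n : nat) : 0 < Re z -> Cshift_prod z n <> 0.
Proof.
  intros Hz. induction n as [|n IH].
  - now apply Cneq_Re.
  - change (Cshift_prod z (S n)) with (Cshift_prod z n * (z + INR (S n)))%C.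
    apply Cmult_neq_0; [exact IH|]. apply Cneq_Re.
    rewrite re_plus, re_RtoC. pose proof (pos_INR (S n)). lra.
Qed.

Lemma Cshift_prod_shift (z : C) (n : nat) :
  (z * Cshift_prod (z + 1) n = Cshift_prod z n * (z + 1 + INR n))%C.
Proof.
  induction n as [|n IH].
  - simpl Cshift_prod. change (INR 0) with 0. ring.
  - change (Cshift_prod z (S n)) with (Cshift_prod z n * (z + INR (S n)))%C.
    change (Cshift_prod (z + 1) (S n)) with (Cshift_prod (z + 1) n * (z + 1 + INR (S n)))%C.
    rewrite Cmult_assoc, IH. rewrite S_INR, RtoC_plus. ring.
Qed.

Lemma gamma_seq_shift (z : C) (n : nat) : 0 < Re z -> (1 <= n)%nat ->
  gamma_seq (z + 1) n = (gamma_seq z n * (z * (INR n / (z + 1 + INR n))))%C.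
Proof.
  intros Hz Hn. unfold gamma_seq.
  rewrite RCpower_plus_1 by exact Hn.
  assert (H1 : (z + 1 + INR n)%C <> 0).
  { apply Cneq_Re. rewrite !re_plus. simpl. pose proof (pos_INR n). lra. }
  assert (H2 := Cshift_prod_neq0 z n Hz).
  assert (H3 : Cshift_prod (z + 1) n <> 0).
  { apply Cshift_prod_neq0. rewrite re_plus; simpl; lra. }
  assert (H4 := Cneq_Re z Hz).
  pose proof (Cshift_prod_shift z n) as E.
  assert (E' : Cshift_prod z n = (z * Cshift_prod (z + 1) n / (z + 1 + INR n))%C).
  { rewrite E. field. exact H1. }
  rewrite E'. field. repeat split; auto.
Qed.

(** The functional equation [Gamma (z + 1) = z Gamma z], in Euler's limit. *)
Lemma gamma_seq_lim_shift (z G : C) : 0 < Re z ->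
  is_Clim (gamma_seq z) G -> is_Clim (gamma_seq (z + 1)) (G * z).
Proof.
  intros Hz HG.
  apply is_Clim_ext_loc with (fun n => (gamma_seq z n * (z * (INR n / (z + 1 + INR n))))%C).
  { exists 1%nat. intros n Hn. symmetry. now apply gamma_seq_shift. }
  replace (G * z)%C with (G * (z * 1))%C by ring.
  apply is_Clim_mult; [exact HG|].
  apply is_Clim_mult; [apply is_Clim_const|].
  apply is_Clim_le_inv with (Cmod (z + 1)). intros n Hn.
  assert (Hp : 0 < INR n) by (apply lt_0_INR; lia).
  assert (Hr : INR n <= Re (z + 1 + INR n)) by (rewrite !re_plus; simpl; lra).
  assert (H1 : (z + 1 + INR n)%C <> 0) by (apply Cneq_Re; lra).
  replace (INR n / (z + 1 + INR n) - 1)%C with (- ((z + 1) / (z + 1 + INR n)))%C by (field; exact H1).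
  rewrite Cmod_opp, Cmod_div by exact H1.
  unfold Rdiv. apply Rmult_le_compat_l; [apply Cmod_ge_0|].
  apply Rinv_le_contravar; [exact Hp|].
  apply Rle_trans with (1 := Hr). apply Rle_trans with (1 := Rle_abs _). apply re_le_Cmod.
Qed.

(** [(1 + i nu)_k] as a product of the factors [j + i nu], [1 <= j <= k]. *)
Fixpoint rising (nu : R) (k : nat) : C :=
  match k with
  | O => 1
  | S p => (rising nu p * (INR (S p), nu))%C
  end.

Lemma rising_neq0 (nu : R) (k : nat) : rising nu k <> 0.
Proof.
  induction k as [|k IH].
  - apply Cneq_Re. simpl. lra.
  - change (rising nu (S k)) with (rising nu k * (INR (S k), nu))%C.
    apply Cmult_neq_0; [exact IH|]. apply Cneq_Re.
    change (0 < INR (S k)). apply lt_0_INR; lia.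
Qed.

Lemma gamma_seq_lim_rising (nu : R) (G : C) (k : nat) :
  is_Clim (gamma_seq (1 + Ci * nu)) G ->
  is_Clim (gamma_seq (1 + Ci * nu + INR k)) (G * rising nu k).
Proof.
  intros HG. induction k as [|k IH].
  - simpl. replace (1 + Ci * nu + 0)%C with (1 + Ci * nu)%C by ring.
    replace (G * 1)%C with G by ring. exact HG.
  - replace (1 + Ci * nu + INR (S k))%C with (1 + Ci * nu + INR k + 1)%C
      by (rewrite S_INR, RtoC_plus; ring).
    change (rising nu (S k)) with (rising nu k * (INR (S k), nu))%C. rewrite Cmult_assoc.
    replace ((INR (S k), nu) : C) with (1 + Ci * nu + INR k)%C.
    + apply gamma_seq_lim_shift; [|exact IH].
      rewrite !re_plus. simpl. pose proof (pos_INR k). lra.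
    + rewrite S_INR. apply injective_projections; simpl; ring.
Qed.

(** The product of [j / |j + i nu|] over [1 <= j <= n + 1]: the modulus in Euler's limit, up to
    the factor [n / (n + 1)]. *)
Fixpoint gamma_modulus (nu : R) (n : nat) : R :=
  match n with
  | O => / sqrt (1 + nu ^ 2)
  | S p => gamma_modulus nu p * ((INR (S p) + 1) / sqrt ((INR (S p) + 1) ^ 2 + nu ^ 2))
  end.

Lemma gamma_modulus_pos (nu : R) (n : nat) : 0 < gamma_modulus nu n.
Proof.
  induction n as [|n IH].
  - simpl gamma_modulus. apply Rinv_0_lt_compat, sqrt_lt_R0. nra.
  - change (gamma_modulus nu (S n)) with
      (gamma_modulus nu n * ((INR (S n) + 1) / sqrt ((INR (S n) + 1) ^ 2 + nu ^ 2))).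
    apply Rmult_lt_0_compat; [exact IH|].
    pose proof (pos_INR (S n)).
    apply Rdiv_lt_0_compat; [lra|]. apply sqrt_lt_R0. nra.
Qed.

Lemma Cshift_prod_polar (nu : R) (n : nat) : 0 < nu ->
  Cshift_prod (1 + Ci * nu) n =
  (RtoC (INR (fact (S n)) / gamma_modulus nu n)
   * cis (sum_f_R0 (fun j => theta nu (INR j + 1)) n))%C.
Proof.
  intros Hnu. induction n as [|n IH].
  - simpl sum_f_R0. change (gamma_modulus nu 0) with (/ sqrt (1 + nu ^ 2)).
    change (Cshift_prod (1 + Ci * nu) 0) with (1 + Ci * nu)%C. simpl INR.
    replace (1 + Ci * nu)%C with ((0 + 1, nu) : C) by (apply injective_projections; simpl; ring).
    rewrite polar_theta by exact Hnu. apply (f_equal (fun a => RtoC a * cis (theta nu (0 + 1)))%C).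
    replace ((0 + 1) ^ 2 + nu ^ 2) with (1 + nu ^ 2) by ring.
    unfold Rdiv. rewrite Rinv_inv. symmetry. apply Rmult_1_l.
  - change (Cshift_prod (1 + Ci * nu) (S n)) with
      (Cshift_prod (1 + Ci * nu) n * (1 + Ci * nu + INR (S n)))%C.
    rewrite IH, tech5, cis_plus.
    replace (1 + Ci * nu + INR (S n))%C with ((INR (S n) + 1, nu) : C)
      by (apply injective_projections; simpl; ring).
    rewrite polar_theta by exact Hnu.
    change (gamma_modulus nu (S n)) with
      (gamma_modulus nu n * ((INR (S n) + 1) / sqrt ((INR (S n) + 1) ^ 2 + nu ^ 2))).
    set (s := sqrt ((INR (S n) + 1) ^ 2 + nu ^ 2)).
    assert (Hs : 0 < s) by (apply sqrt_lt_R0; pose proof (pos_INR (S n)); nra).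
    pose proof (gamma_modulus_pos nu n) as Hm. pose proof (pos_INR (S n)) as Hp.
    assert (Hf : INR (fact (S (S n))) = (INR (S n) + 1) * INR (fact (S n))).
    { change (fact (S (S n))) with (S (S n) * fact (S n))%nat. rewrite mult_INR, (S_INR (S n)). reflexivity. }
    rewrite Hf.
    replace ((INR (S n) + 1) * INR (fact (S n)) / (gamma_modulus nu n * ((INR (S n) + 1) / s)))
      with (INR (fact (S n)) / gamma_modulus nu n * s) by (field; lra).
    rewrite RtoC_mult. ring.
Qed.

Lemma gamma_seq_polar (nu : R) (n : nat) : 0 < nu -> (1 <= n)%nat ->
  gamma_seq (1 + Ci * nu) n =
  (RtoC (gamma_modulus nu n * (INR n / (INR n + 1))) * cis (gamma_phase_seq nu n))%C.
Proof.
  intros Hnu Hn. assert (Hp : 0 < INR n) by (apply lt_0_INR; lia).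
  unfold gamma_seq. rewrite Cshift_prod_polar by exact Hnu.
  assert (HR : RCpower (INR n) (1 + Ci * nu) = (RtoC (INR n) * cis (nu * ln (INR n)))%C).
  { unfold RCpower, Cexp, cis, Ci, Cmult, Cplus, RtoC; simpl.
    replace (ln (INR n) * (1 + (0 * nu - 1 * 0)) - 0 * (0 + (0 * 0 + 1 * nu))) with (ln (INR n)) by ring.
    replace (ln (INR n) * (0 + (0 * 0 + 1 * nu)) + 0 * (1 + (0 * nu - 1 * 0))) with (nu * ln (INR n)) by ring.
    rewrite exp_ln by lra. apply injective_projections; simpl; ring. }
  rewrite HR. unfold gamma_phase_seq, Rminus. rewrite cis_plus, <- cis_inv.
  set (th := sum_f_R0 _ n).
  pose proof (gamma_modulus_pos nu n) as Hm. pose proof (INR_fact_lt_0 n) as Hf.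
  change (fact (S n)) with (S n * fact n)%nat. rewrite mult_INR, S_INR.
  replace ((INR n + 1) * INR (fact n) / gamma_modulus nu n) with (/ (gamma_modulus nu n / ((INR n + 1) * INR (fact n)))) by (field; lra).
  rewrite RtoC_inv.
  2: { apply Rgt_not_eq. apply Rdiv_lt_0_compat; nra. }
  replace (gamma_modulus nu n * (INR n / (INR n + 1))) with (INR (fact n) * INR n * (gamma_modulus nu n / ((INR n + 1) * INR (fact n)))) by (field; lra).
  rewrite !RtoC_mult. field. split; [apply cis_neq0|].
  intros E. apply RtoC_inj in E. revert E. apply Rgt_not_eq. apply Rdiv_lt_0_compat; nra.
Qed.

(** From [j / |j + i nu| >= exp (- nu^2 / j^2)] and [sum_(j <= n+1) 1 / j^2 <= 2 - 1 / (n + 1)].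
    This bound keeps the limit of the moduli away from [0]. *)
Lemma gamma_modulus_lower (nu : R) (n : nat) :
  exp (- (nu ^ 2) * (2 - / (INR n + 1))) <= gamma_modulus nu n.
Proof.
  assert (Hf : forall y : R, 1 <= y -> exp (- (nu ^ 2 / y ^ 2)) <= y / sqrt (y ^ 2 + nu ^ 2)).
  { intros y Hy.
    assert (Hq : 0 <= nu ^ 2 / y ^ 2).
    { apply Rmult_le_pos; [nra|]. left. apply Rinv_0_lt_compat. nra. }
    assert (Hs : sqrt (y ^ 2 + nu ^ 2) <= y * exp (nu ^ 2 / y ^ 2)).
    { pose proof (exp_ineq1_le (nu ^ 2 / y ^ 2)) as He.
      apply Rle_trans with (sqrt ((y * exp (nu ^ 2 / y ^ 2)) ^ 2)).
      - apply sqrt_le_1_alt.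
        replace (y ^ 2 + nu ^ 2) with (y ^ 2 * (1 + nu ^ 2 / y ^ 2)) by (field; lra).
        rewrite Rpow_mult_distr. apply Rmult_le_compat_l; [nra|]. nra.
      - rewrite sqrt_pow2; [lra|]. apply Rmult_le_pos; [lra|]. left; apply exp_pos. }
    assert (0 < sqrt (y ^ 2 + nu ^ 2)) by (apply sqrt_lt_R0; nra).
    pose proof (exp_pos (nu ^ 2 / y ^ 2)).
    rewrite exp_Ropp. apply Rmult_le_reg_r with (sqrt (y ^ 2 + nu ^ 2)); [lra|].
    unfold Rdiv. rewrite (Rmult_assoc y), Rinv_l, Rmult_1_r by lra.
    apply Rmult_le_reg_l with (exp (nu ^ 2 / y ^ 2)); [lra|].
    rewrite <- Rmult_assoc. unfold Rdiv in *. rewrite Rinv_r, Rmult_1_l by lra. lra. }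
  induction n as [|n IH].
  - simpl gamma_modulus. simpl INR. specialize (Hf 1 ltac:(lra)).
    replace (1 / sqrt (1 ^ 2 + nu ^ 2)) with (/ sqrt (1 + nu ^ 2)) in Hf.
    2: { rewrite pow1. unfold Rdiv; ring. }
    replace (- nu ^ 2 * (2 - / (0 + 1))) with (- (nu ^ 2 / 1 ^ 2)) by field. exact Hf.
  - change (gamma_modulus nu (S n)) with
      (gamma_modulus nu n * ((INR (S n) + 1) / sqrt ((INR (S n) + 1) ^ 2 + nu ^ 2))).
    pose proof (pos_INR n) as Hp. rewrite S_INR. set (y := INR n + 1) in *.
    assert (Hy : 1 <= y) by (unfold y; lra).
    specialize (Hf (y + 1) ltac:(lra)).
    apply Rle_trans with (exp (- nu ^ 2 * (2 - / y)) * exp (- (nu ^ 2 / (y + 1) ^ 2))).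
    + rewrite <- exp_plus.
      assert (Hd : / (y + 1) ^ 2 <= / y - / (y + 1)).
      { replace (/ y - / (y + 1)) with (/ (y * (y + 1))) by (field; lra).
        apply Rinv_le_contravar; nra. }
      destruct (Rle_lt_or_eq_dec (- nu ^ 2 * (2 - / (y + 1)))
         (- nu ^ 2 * (2 - / y) + - (nu ^ 2 / (y + 1) ^ 2))) as [H|H].
      * unfold Rdiv. pose proof (pow2_ge_0 nu). nra.
      * left. now apply exp_increasing.
      * rewrite H. lra.
    + apply Rmult_le_compat; auto; left; apply exp_pos.
Qed.

Lemma gamma_modulus_lim (nu : R) :
  exists r, 0 < r /\ is_lim_seq (fun n => gamma_modulus nu n * (INR n / (INR n + 1))) r.
Proof.
  set (m := exp (- (2 * nu ^ 2))).
  assert (Hlow : forall n, m <= gamma_modulus nu n).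
  { intros n. apply Rle_trans with (2 := gamma_modulus_lower nu n). unfold m.
    assert (0 < / (INR n + 1)) by (apply Rinv_0_lt_compat; pose proof (pos_INR n); lra).
    destruct (Rle_lt_or_eq_dec (- (2 * nu ^ 2)) (- nu ^ 2 * (2 - / (INR n + 1)))) as [H1|H1].
    - pose proof (pow2_ge_0 nu). nra.
    - left. now apply exp_increasing.
    - rewrite H1; lra. }
  destruct (ex_finite_lim_seq_decr (gamma_modulus nu) m) as [r Hr].
  - intros n. change (gamma_modulus nu (S n)) with
      (gamma_modulus nu n * ((INR (S n) + 1) / sqrt ((INR (S n) + 1) ^ 2 + nu ^ 2))).
    rewrite <- (Rmult_1_r (gamma_modulus nu n)) at 2.
    apply Rmult_le_compat_l; [left; apply gamma_modulus_pos|].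
    pose proof (pos_INR (S n)).
    set (y := INR (S n) + 1). assert (Hy : 1 <= y) by (unfold y; lra).
    assert (y <= sqrt (y ^ 2 + nu ^ 2)).
    { rewrite <- (sqrt_pow2 y) at 1 by lra. apply sqrt_le_1_alt. pose proof (pow2_ge_0 nu). lra. }
    apply Rmult_le_reg_r with (sqrt (y ^ 2 + nu ^ 2)); [lra|].
    unfold Rdiv. rewrite Rmult_assoc, Rinv_l by lra. lra.
  - exact Hlow.
  - exists r. split.
    + apply Rlt_le_trans with m; [apply exp_pos|].
      apply (is_lim_seq_le (fun _ => m) (gamma_modulus nu) m r); auto. apply is_lim_seq_const.
    + replace (Finite r) with (Finite (r * 1)) by (f_equal; ring).
      apply is_lim_seq_mult'; [exact Hr|].
      apply is_lim_seq_ext with (fun n => (INR n / (INR n + 1) - 1) + 1); [intros; ring|].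
      replace (Finite 1) with (Finite (0 + 1)) by (f_equal; ring).
      apply is_lim_seq_plus'; [|apply is_lim_seq_const].
      apply is_lim_seq_le_inv with 1. intros n Hn.
      assert (Hp : 0 < INR n) by (apply lt_0_INR; lia).
      replace (INR n / (INR n + 1) - 1) with (- / (INR n + 1)) by (field; lra).
      rewrite Rabs_Ropp, Rabs_pos_eq by (left; apply Rinv_0_lt_compat; lra).
      unfold Rdiv. rewrite Rmult_1_l. apply Rinv_le_contravar; lra.
Qed.

(** The modulus and the argument of Euler's limit converge separately; the positive modulus also
    shows that [Gamma (1 + i nu)] does not vanish. *)
Lemma gamma_polar (nu : R) : 1 <= nu ->
  exists r, 0 < r /\
    is_Clim (gamma_seq (1 + Ci * nu)) (RtoC r * cis (gamma_phase nu))%C.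
Proof.
  intros Hnu. destruct (gamma_modulus_lim nu) as [r [Hr Hl]].
  exists r. split; [exact Hr|].
  apply is_Clim_ext_loc with (fun n =>
    (RtoC (gamma_modulus nu n * (INR n / (INR n + 1))) * cis (gamma_phase_seq nu n))%C).
  { exists 1%nat. intros n Hn. symmetry. apply gamma_seq_polar; [lra|exact Hn]. }
  apply is_Clim_mult.
  - split; [exact Hl|apply is_lim_seq_const].
  - destruct (gamma_phase_lim nu Hnu) as [Hp _].
    split; simpl.
    + apply is_lim_seq_continuous; [apply continuity_cos|exact Hp].
    + apply is_lim_seq_continuous; [apply continuity_sin|exact Hp].
Qed.

Lemma pochhammer_rising (nu : R) (k : nat) : 1 <= nu ->
  pochhammer (1 + Ci * nu) k = rising nu k.
Proof.
  intros Hnu. destruct (gamma_polar nu Hnu) as [r [Hr HG]].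
  pose proof (gamma_seq_lim_rising nu _ k HG) as Hk.
  unfold pochhammer, CGamma. fold (gamma_seq (1 + Ci * nu)). fold (gamma_seq (1 + Ci * nu + INR k)).
  rewrite (is_Clim_unique _ _ HG), (is_Clim_unique _ _ Hk).
  field. split; [apply cis_neq0|]. intros E. apply RtoC_inj in E. lra.
Qed.

(** * The power series of the Bessel function *)

(** The coefficients of the power series of [J], with [d = - x^2 / 4]. *)
Definition exp_coef (d : R) (k : nat) : R := d ^ k / INR (fact k).

Lemma exp_coef_abs_series (d : R) :
  is_series (fun k => Rabs (exp_coef d k)) (exp (Rabs d)).
Proof.
  apply is_series_ext with (2 := is_exp_Reals (Rabs d)).
  intros k. unfold exp_coef, scal; simpl; unfold mult; simpl.
  rewrite pow_n_pow. unfold Rdiv. rewrite Rabs_mult, RPow_abs.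
  rewrite (Rabs_pos_eq (/ _)); [reflexivity|].
  left. apply Rinv_0_lt_compat, INR_fact_lt_0.
Qed.

Lemma Series_weight_le (e w : nat -> R) (E M : R) :
  is_series (fun k => Rabs (e k)) E -> (forall k, Rabs (w k) <= M) ->
  ex_series (fun k => e k * w k) /\ Rabs (Series (fun k => e k * w k)) <= M * E.
Proof.
  intros HE Hw.
  assert (HM : is_series (fun k => M * Rabs (e k)) (M * E)) by exact (is_series_scal_l M _ _ HE).
  assert (Hb : forall k, Rabs (e k * w k) <= M * Rabs (e k)).
  { intros k. rewrite Rabs_mult, Rmult_comm. apply Rmult_le_compat_r; [apply Rabs_pos|apply Hw]. }
  assert (Hex : ex_series (fun k => Rabs (e k * w k))).
  { apply (@ex_series_le R_AbsRing R_CompleteNormedModule) with (fun k => M * Rabs (e k)).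
    - intros k. unfold norm; simpl. unfold abs; simpl. rewrite Rabs_Rabsolu. apply Hb.
    - eexists; exact HM. }
  split; [now apply ex_series_Rabs|].
  apply Rle_trans with (1 := Series_Rabs _ Hex).
  rewrite <- (is_series_unique _ _ HM).
  apply Series_le; [|eexists; exact HM].
  intros k; split; [apply Rabs_pos|apply Hb].
Qed.

(** The splitting index [7] is the first from which [|1 / (1 + i nu)_k| <= nu ^ -7] for [nu >= 1]. *)
Lemma Series_weight_tail (e w : nat -> R) (E M1 M : R) :
  is_series (fun k => Rabs (e k)) E -> (forall k, Rabs (w k) <= M1) ->
  (forall k, (7 <= k)%nat -> Rabs (w k) <= M) ->
  Rabs (Series (fun k => e k * w k) - sum_f_R0 (fun k => e k * w k) 6) <= M * E.
Proof.
  intros HE H1 H7.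
  assert (M0 : 0 <= M) by (apply Rle_trans with (2 := H7 7%nat ltac:(lia)); apply Rabs_pos).
  destruct (Series_weight_le e w E M1 HE H1) as [Hex _].
  set (w' := fun k => if le_dec 7 k then w k else 0).
  assert (Hw' : forall k, Rabs (w' k) <= M).
  { intros k. unfold w'. destruct (le_dec 7 k); [auto|rewrite Rabs_R0; exact M0]. }
  destruct (Series_weight_le e w' E M HE Hw') as [Hex' Hle].
  replace (Series (fun k => e k * w k) - sum_f_R0 (fun k => e k * w k) 6)
    with (Series (fun k => e k * w' k)); [exact Hle|].
  rewrite (Series_incr_n (fun k => e k * w k) 7) by (auto; lia).
  rewrite (Series_incr_n_aux (fun k => e k * w' k) 7).
  - simpl Nat.pred.
    rewrite (Series_ext (fun k => e (7 + k)%nat * w' (7 + k)%nat) (fun k => e (7 + k)%nat * w (7 + k)%nat)).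
    + ring.
    + intros k. unfold w'. destruct (le_dec 7 (7 + k)); [reflexivity|lia].
  - intros k Hk. unfold w'. destruct (le_dec 7 k); [lia|ring].
Qed.

Lemma Cmod_shift_ge (nu : R) (k : nat) : 0 < nu ->
  nu <= Cmod (INR k, nu) /\ INR k <= Cmod (INR k, nu).
Proof.
  intros Hnu. pose proof (Rmax_Cmod (INR k, nu)) as H. simpl in H.
  split; apply Rle_trans with (2 := H).
  - apply Rle_trans with (2 := Rmax_r _ _). apply Rle_abs.
  - apply Rle_trans with (2 := Rmax_l _ _). apply Rle_abs.
Qed.

Lemma rising_S (nu : R) (k : nat) : rising nu (S k) = (rising nu k * (INR (S k), nu))%C.
Proof. reflexivity. Qed.

Lemma Cmod_rising_ge (nu : R) (k : nat) : 0 < nu -> nu ^ k <= Cmod (rising nu k).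
Proof.
  intros Hnu. induction k as [|k IH].
  - simpl. rewrite Cmod_1. lra.
  - rewrite rising_S, Cmod_mult, <- tech_pow_Rmult, Rmult_comm.
    apply Rmult_le_compat; [apply pow_le; lra|lra|exact IH|].
    now apply Cmod_shift_ge.
Qed.

Lemma Cmod_inv_rising_le (nu : R) (k j : nat) : 1 <= nu -> (j <= k)%nat ->
  Cmod (/ rising nu k) <= (/ nu) ^ j.
Proof.
  intros Hnu Hj. rewrite Cmod_inv by apply rising_neq0. rewrite pow_inv.
  apply Rinv_le_contravar; [apply pow_lt; lra|].
  apply Rle_trans with (2 := Cmod_rising_ge nu k ltac:(lra)).
  apply Rle_pow; auto.
Qed.

Lemma shift_neq0 (nu : R) (k : nat) : 0 < nu -> ((INR k, nu) : C) <> 0.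
Proof. intros H E. injection E. lra. Qed.

(** Passing from [k] to [k + 1] adds one factor [1 / (k + 1 + i nu)], of modulus and Lipschitz
    constant at most [1]. *)
Lemma inv_rising_lipschitz (a b : R) (k : nat) : 1 <= a -> 1 <= b ->
  Cmod (/ rising a k - / rising b k) <= INR k * Rabs (a - b).
Proof.
  intros Ha Hb. induction k as [|k IH].
  - simpl. replace (/ 1 - / 1)%C with (RtoC 0) by ring. rewrite Cmod_0. lra.
  - rewrite !rising_S.
    pose proof (shift_neq0 a (S k) ltac:(lra)) as Na.
    pose proof (shift_neq0 b (S k) ltac:(lra)) as Nb.
    pose proof (rising_neq0 a k) as Ra. pose proof (rising_neq0 b k) as Rb.
    assert (Ga : Cmod (/ (INR (S k), a)) <= 1).
    { rewrite Cmod_inv, <- Rinv_1 by exact Na. apply Rinv_le_contravar; [lra|].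
      pose proof (proj1 (Cmod_shift_ge a (S k) ltac:(lra))). lra. }
    assert (Gb : Cmod (/ (INR (S k), b)) <= 1).
    { rewrite Cmod_inv, <- Rinv_1 by exact Nb. apply Rinv_le_contravar; [lra|].
      pose proof (proj1 (Cmod_shift_ge b (S k) ltac:(lra))). lra. }
    pose proof (Cmod_inv_rising_le b k 0 Hb ltac:(lia)) as Qb. simpl in Qb.
    assert (Ed : ((INR (S k), b) - (INR (S k), a))%C = (Ci * (b - a))%C).
    { apply injective_projections; simpl; ring. }
    assert (Ef : forall p q z w : C, p <> 0 -> q <> 0 -> z <> 0 -> w <> 0 ->
      (/ (p * z) - / (q * w) = (/ p - / q) * / z + / q * ((/ z * / w) * (w - z)))%C)
      by (intros; field; auto).
    rewrite Ef, Ed by assumption.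
    apply Rle_trans with (1 := Cmod_triangle _ _). rewrite !Cmod_mult, Cmod_Ci.
    rewrite <- RtoC_minus, Cmod_R, (Rabs_minus_sym b a).
    replace (INR (S k) * Rabs (a - b)) with (INR k * Rabs (a - b) + 1 * Rabs (a - b)) by (rewrite S_INR; ring).
    pose proof (Cmod_ge_0 (/ (INR (S k), a))). pose proof (Cmod_ge_0 (/ (INR (S k), b))).
    pose proof (Cmod_ge_0 (/ rising b k)). pose proof (Rabs_pos (a - b)).
    pose proof (Cmod_ge_0 (/ rising a k - / rising b k)).
    apply Rplus_le_compat; [nra|].
    rewrite !Rmult_1_l.
    apply Rle_trans with (1 * (1 * 1 * Rabs (a - b))); [|lra].
    apply Rmult_le_compat; try lra.
    + repeat apply Rmult_le_pos; lra.
    + apply Rmult_le_compat_r; [lra|]. apply Rmult_le_compat; lra.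
Qed.

(** With [bessel_im], the two parts of the power series in [J] of order [i nu], which stands without
    the factor [(x/2) ^ (i nu) / Gamma (1 + i nu)]. *)
Definition bessel_re (x nu : R) : R :=
  Series (fun k => exp_coef (- (x ^ 2 / 4)) k * Re (/ rising nu k)).
Definition bessel_im (x nu : R) : R :=
  Series (fun k => exp_coef (- (x ^ 2 / 4)) k * Im (/ rising nu k)).

Lemma INR_le_pow2 (k : nat) : INR k <= 2 ^ k.
Proof.
  induction k as [|k IH]; [simpl; lra|].
  rewrite S_INR, <- tech_pow_Rmult. pose proof (pow_R1_Rle 2 k ltac:(lra)). lra.
Qed.

(** The factor [k] from [inv_rising_lipschitz] is absorbed by [k <= 2 ^ k], that is, by replacing
    [d] by [2 d] in the exponential series. *)
Lemma Series_rising_lipschitz (f : C -> R) (d a b : R) :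
  (forall z, Rabs (f z) <= Cmod z) -> (forall y z, f (y - z)%C = f y - f z) ->
  1 <= a -> 1 <= b ->
  Rabs (Series (fun k => exp_coef d k * f (/ rising a k)%C)
        - Series (fun k => exp_coef d k * f (/ rising b k)%C)) <= exp (Rabs (2 * d)) * Rabs (a - b).
Proof.
  intros Hf Hlin Ha Hb.
  assert (Hex : forall c, 1 <= c -> ex_series (fun k => exp_coef d k * f (/ rising c k)%C)).
  { intros c Hc. apply (Series_weight_le _ _ _ 1 (exp_coef_abs_series d)).
    intros k. apply Rle_trans with (1 := Hf _). apply (Cmod_inv_rising_le c k 0); [exact Hc|lia]. }
  rewrite <- Series_minus by auto.
  rewrite (Series_ext _ (fun k => exp_coef (2 * d) k * (/ 2 ^ k * f (/ rising a k - / rising b k)%C))).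
  - rewrite (Rmult_comm (exp _)).
    apply (Series_weight_le _ _ _ (Rabs (a - b)) (exp_coef_abs_series (2 * d))).
    intros k. assert (H2 : 0 < 2 ^ k) by (apply pow_lt; lra).
    rewrite Rabs_mult, Rabs_pos_eq by (left; now apply Rinv_0_lt_compat).
    apply Rmult_le_reg_l with (2 ^ k); [exact H2|].
    rewrite <- Rmult_assoc, Rinv_r, Rmult_1_l by lra.
    apply Rle_trans with (1 := Hf _).
    apply Rle_trans with (1 := inv_rising_lipschitz a b k Ha Hb).
    apply Rmult_le_compat_r; [apply Rabs_pos|apply INR_le_pow2].
  - intros k. rewrite Hlin. unfold exp_coef. rewrite Rpow_mult_distr. field.
    split; [apply pow_nonzero; lra|apply INR_fact_neq_0].
Qed.

Lemma bessel_lipschitz (x a b : R) : 1 <= a -> 1 <= b ->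
  Rabs (bessel_re x a - bessel_re x b) <= exp (Rabs (2 * - (x ^ 2 / 4))) * Rabs (a - b) /\
  Rabs (bessel_im x a - bessel_im x b) <= exp (Rabs (2 * - (x ^ 2 / 4))) * Rabs (a - b).
Proof.
  intros Ha Hb. split.
  - apply (Series_rising_lipschitz Re); [apply re_le_Cmod| |exact Ha|exact Hb].
    intros y z. unfold Cminus. now rewrite re_plus, re_opp.
  - apply (Series_rising_lipschitz Im); [apply Im_le_Cmod| |exact Ha|exact Hb].
    intros y z. unfold Cminus. now rewrite im_plus, im_opp.
Qed.

(** Multiplying by [k + 1 + z], where [s = 1 / z], must turn the truncation [T'] for [k + 1] into
    the one for [k], up to the single term [kappa s ^ 6] which the truncation cuts off; dividing
    the error by [k + 1 + z] then gains a factor [1 / nu]. *)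
Lemma inv_rising_expand_step (nu : R) (k : nat) (T T' s : C) (M kappa : R) :
  1 <= nu -> s = (/ ((0, nu) : C))%C ->
  Cmod (/ rising nu k - T) <= M * (/ nu) ^ 7 ->
  (T' * (INR (S k) + / s) = T + kappa * s ^ 6)%C ->
  Cmod (/ rising nu (S k) - T') <= (M + Rabs kappa) * (/ nu) ^ 7.
Proof.
  intros Hnu Hs HT E.
  assert (Nz : ((0, nu) : C) <> 0) by (intros H; injection H; lra).
  assert (Ez : ((INR (S k), nu) : C) = (INR (S k) + / s)%C).
  { assert (Hi : forall z : C, z <> 0 -> (/ / z = z)%C) by (intros; field; auto).
    rewrite Hs, Hi by exact Nz.
    apply injective_projections; simpl; ring. }
  pose proof (shift_neq0 nu (S k) ltac:(lra)) as Nk. pose proof (rising_neq0 nu k) as Nr.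
  rewrite rising_S.
  replace (/ (rising nu k * (INR (S k), nu)) - T')%C
    with ((/ rising nu k - T - kappa * s ^ 6) * / (INR (S k), nu))%C.
  2: { replace (/ rising nu k - T - kappa * s ^ 6)%C with (/ rising nu k - (T + kappa * s ^ 6))%C by ring.
       rewrite <- E, <- Ez. field. auto. }
  assert (Hms : Cmod s = / nu).
  { rewrite Hs, Cmod_inv by exact Nz. f_equal.
    unfold Cmod; simpl. replace (0 * (0 * 1) + nu * (nu * 1)) with (nu ^ 2) by ring.
    apply sqrt_pow2. lra. }
  assert (Ht : 0 < / nu <= 1).
  { split; [apply Rinv_0_lt_compat; lra|]. rewrite <- Rinv_1. apply Rinv_le_contravar; lra. }
  rewrite Cmod_mult.
  assert (H1 : Cmod (/ rising nu k - T - kappa * s ^ 6) <= M * (/ nu) ^ 7 + Rabs kappa * (/ nu) ^ 6).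
  { unfold Cminus at 1. apply Rle_trans with (1 := Cmod_triangle _ _).
    rewrite Cmod_opp, Cmod_mult, Cmod_pow, Hms, Cmod_R. lra. }
  assert (H2 : Cmod (/ (INR (S k), nu)) <= / nu).
  { rewrite Cmod_inv by exact Nk. apply Rinv_le_contravar; [lra|]. apply Cmod_shift_ge; lra. }
  assert (HM : 0 <= M * (/ nu) ^ 7) by (apply Rle_trans with (2 := HT); apply Cmod_ge_0).
  apply Rle_trans with ((M * (/ nu) ^ 7 + Rabs kappa * (/ nu) ^ 6) * / nu).
  { apply Rmult_le_compat; auto using Cmod_ge_0. }
  set (t := / nu) in *.
  replace ((M * t ^ 7 + Rabs kappa * t ^ 6) * t) with ((M * t ^ 7) * t + Rabs kappa * t ^ 7) by ring.
  nra.
Qed.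

(** [1 / (1 + z)_k] expanded in [s = 1 / z] up to [s ^ 6]; the coefficients are, up to sign,
    Stirling numbers of the second kind.  The order is [6] although the phase is wanted up
    to [s ^ 5]: [s ^ 6] is real for imaginary [z], but an error [O(s ^ 6)] might not be. *)
Definition inv_rising_trunc (k : nat) (s : C) : C :=
  match k with
  | 0%nat => 1
  | 1%nat => s - s ^ 2 + s ^ 3 - s ^ 4 + s ^ 5 - s ^ 6
  | 2%nat => s ^ 2 - 3 * s ^ 3 + 7 * s ^ 4 - 15 * s ^ 5 + 31 * s ^ 6
  | 3%nat => s ^ 3 - 6 * s ^ 4 + 25 * s ^ 5 - 90 * s ^ 6
  | 4%nat => s ^ 4 - 10 * s ^ 5 + 65 * s ^ 6
  | 5%nat => s ^ 5 - 15 * s ^ 6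
  | _ => s ^ 6
  end%C.

Lemma inv_rising_expand (nu : R) (k : nat) : 1 <= nu -> (k <= 6)%nat ->
  Cmod (/ rising nu k - inv_rising_trunc k (/ (0, nu))) <= 876 * (/ nu) ^ 7.
Proof.
  intros Hnu Hk.
  assert (Nz : ((0, nu) : C) <> 0) by (intros H; injection H; lra).
  set (s := (/ (0, nu))%C).
  assert (Ns : s <> 0).
  { intros E. pose proof (Cinv_r _ Nz) as H. fold s in H. rewrite E, Cmult_0_r in H.
    injection H; lra. }
  assert (H0 : Cmod (/ rising nu 0 - inv_rising_trunc 0 s) <= 0 * (/ nu) ^ 7).
  { simpl. replace (/ 1 - 1)%C with (RtoC 0) by field. rewrite Cmod_0. lra. }
  assert (H1 := inv_rising_expand_step nu 0 _ (inv_rising_trunc 1 s) s _ (-1) Hnu eq_refl H0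
    ltac:(simpl INR; unfold inv_rising_trunc; field; exact Ns)).
  assert (H2 := inv_rising_expand_step nu 1 _ (inv_rising_trunc 2 s) s _ 63 Hnu eq_refl H1
    ltac:(simpl INR; rewrite ?RtoC_plus; unfold inv_rising_trunc; field; exact Ns)).
  assert (H3 := inv_rising_expand_step nu 2 _ (inv_rising_trunc 3 s) s _ (-301) Hnu eq_refl H2
    ltac:(simpl INR; rewrite ?RtoC_plus; unfold inv_rising_trunc; field; exact Ns)).
  assert (H4 := inv_rising_expand_step nu 3 _ (inv_rising_trunc 4 s) s _ 350 Hnu eq_refl H3
    ltac:(simpl INR; rewrite ?RtoC_plus; unfold inv_rising_trunc; field; exact Ns)).
  assert (H5 := inv_rising_expand_step nu 4 _ (inv_rising_trunc 5 s) s _ (-140) Hnu eq_refl H4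
    ltac:(simpl INR; rewrite ?RtoC_plus; unfold inv_rising_trunc; field; exact Ns)).
  assert (H6 := inv_rising_expand_step nu 5 _ (inv_rising_trunc 6 s) s _ 21 Hnu eq_refl H5
    ltac:(simpl INR; rewrite ?RtoC_plus; unfold inv_rising_trunc; field; exact Ns)).
  assert (Ht : 0 < (/ nu) ^ 7) by (apply pow_lt, Rinv_0_lt_compat; lra).
  assert (Ha : forall z y, Cmod z <= y * (/ nu) ^ 7 -> y <= 876 -> Cmod z <= 876 * (/ nu) ^ 7)
    by (intros; nra).
  destruct k as [|[|[|[|[|[|[|k]]]]]]]; [| | | | | | |lia].
  1: apply (Ha _ _ H0). 2: apply (Ha _ _ H1). 3: apply (Ha _ _ H2). 4: apply (Ha _ _ H3).
  5: apply (Ha _ _ H4). 6: apply (Ha _ _ H5). 7: apply (Ha _ _ H6).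
  all: rewrite ?(Rabs_left (-1)), ?(Rabs_left (-301)), ?(Rabs_left (-140)),
     ?(Rabs_pos_eq 63), ?(Rabs_pos_eq 350), ?(Rabs_pos_eq 21) by lra; lra.
Qed.

Lemma inv_imaginary (nu : R) : 0 < nu -> (/ ((0, nu) : C))%C = (0, - / nu).
Proof. intros H. apply injective_projections; simpl; field; lra. Qed.

Definition at_infinity : (R -> Prop) -> Prop := Rbar_locally p_infty.

Global Instance at_infinity_filter : ProperFilter at_infinity.
Proof. exact (Rbar_locally_filter p_infty). Qed.

Lemma scale_inv : scale at_infinity (fun nu => / nu).
Proof.
  exists 1. intros nu H. split; [apply Rinv_0_lt_compat; lra|].
  rewrite <- Rinv_1. apply Rinv_le_contravar; lra.
Qed.

(** [f] is the real or the imaginary part. *)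
Lemma Series_rising_expand (f : C -> R) (d : R) :
  (forall z, Rabs (f z) <= Cmod z) -> (forall y z, f (y - z)%C = f y - f z) ->
  bigO at_infinity (fun nu => / nu) 7 (fun nu => Series (fun k => exp_coef d k * f (/ rising nu k)%C)
     - sum_f_R0 (fun k => exp_coef d k * f (inv_rising_trunc k (0, - / nu))) 6).
Proof.
  intros Hf Hlin.
  exists (exp (Rabs d) + exp (Rabs d) * 876). exists 1. intros nu Hnu.
  assert (Ht : 0 < (/ nu) ^ 7) by (apply pow_lt, Rinv_0_lt_compat; lra).
  assert (Hq : forall k j, (j <= k)%nat -> Rabs (f (/ rising nu k)%C) <= (/ nu) ^ j).
  { intros k j Hj. apply Rle_trans with (1 := Hf _). apply Cmod_inv_rising_le; [lra|exact Hj]. }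
  pose proof (Series_weight_tail (exp_coef d) (fun k => f (/ rising nu k)%C) _ 1 ((/ nu) ^ 7)
     (exp_coef_abs_series d) (fun k => Hq k 0%nat (Nat.le_0_l k)) (fun k Hk => Hq k 7%nat Hk)) as HT.
  set (S := Series _) in *. set (S6 := sum_f_R0 _ 6) in HT. set (P6 := sum_f_R0 _ 6).
  assert (HP : Rabs (S6 - P6) <= exp (Rabs d) * (876 * (/ nu) ^ 7)).
  { unfold S6, P6. rewrite <- minus_sum.
    apply Rle_trans with (1 := Rsum_abs _ _).
    apply Rle_trans with (sum_f_R0 (fun k => Rabs (exp_coef d k) * (876 * (/ nu) ^ 7)) 6).
    - apply sum_Rle. intros k Hk. rewrite <- Rmult_minus_distr_l, Rabs_mult.
      apply Rmult_le_compat_l; [apply Rabs_pos|]. rewrite <- Hlin.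
      apply Rle_trans with (1 := Hf _). rewrite <- inv_imaginary by lra.
      apply inv_rising_expand; [lra|exact Hk].
    - rewrite <- scal_sum, Rmult_comm. apply Rmult_le_compat_r; [lra|].
      rewrite <- (is_series_unique _ _ (exp_coef_abs_series d)).
      pose proof (exp_coef_abs_series d) as He.
      assert (Hex : ex_series (fun k => Rabs (exp_coef d k))) by (eexists; exact He).
      rewrite (Series_incr_n (fun k => Rabs (exp_coef d k)) 7) by (auto; lia).
      simpl Nat.pred.
      assert (0 <= Series (fun k => Rabs (exp_coef d (7 + k)%nat))).
      { assert (Hex' : ex_series (fun k => Rabs (exp_coef d (7 + k)%nat)))
          by exact (proj1 (ex_series_incr_n (fun k => Rabs (exp_coef d k)) 7) Hex).
        pose proof (Series_le (fun _ => 0) _ (fun k => conj (Rle_refl 0) (Rabs_pos (exp_coef d (7 + k)))) Hex') as H0.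
        replace (Series (fun _ : nat => 0)) with 0 in H0; [exact H0|].
        symmetry. rewrite (Series_ext _ (fun k => 0 * (fun _ => 0) k)) by (intros; ring).
        rewrite Series_scal_l. ring. }
      lra. }
  replace (S - P6) with ((S - S6) + (S6 - P6)) by ring.
  apply Rle_trans with (1 := Rabs_triang _ _). lra.
Qed.

Lemma bessel_re_expand (x : R) :
  let d := - (x ^ 2 / 4) in
  bigO at_infinity (fun nu => / nu) 6
    (fun nu => bessel_re x nu - (1 - Cpoly 2 d * (/ nu) ^ 2 + Cpoly 4 d * (/ nu) ^ 4)).
Proof.
  intros d.
  pose proof (Series_rising_expand Re d re_le_Cmod) as H.
  specialize (H ltac:(intros; unfold Cminus; now rewrite re_plus, re_opp)).
  apply (bigO_weaken _ _ 7 6) in H; [|apply scale_inv|lia].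
  (* [c6] is the coefficient of [(/ nu) ^ 6] in the real part of the truncations. *)
  set (c6 := - (exp_coef d 1 * (-1) + exp_coef d 2 * 31 + exp_coef d 3 * (-90) + exp_coef d 4 * 65 + exp_coef d 5 * (-15) + exp_coef d 6)).
  apply bigO_ext with (f := fun nu => (Series (fun k => exp_coef d k * Re (/ rising nu k))
     - sum_f_R0 (fun k => exp_coef d k * Re (inv_rising_trunc k (0, - / nu))) 6) + (/ nu) ^ 6 * c6); [typeclasses eauto| |].
  - apply filter_forall. intros nu. unfold bessel_re. fold d.
    set (S := Series _). simpl sum_f_R0. generalize (/ nu). intros t. unfold c6, exp_coef, Cpoly. simpl. field.
  - apply bigO_plus; [typeclasses eauto|exact H|].
    apply bigO_factor; [typeclasses eauto|apply scale_inv|]. apply bigO_const. typeclasses eauto.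
Qed.

Lemma bessel_im_expand (x : R) :
  let d := - (x ^ 2 / 4) in
  bigO at_infinity (fun nu => / nu) 7
    (fun nu => bessel_im x nu
      - (- (Cpoly 1 d * / nu) + Cpoly 3 d * (/ nu) ^ 3 - Cpoly 5 d * (/ nu) ^ 5)).
Proof.
  intros d.
  pose proof (Series_rising_expand Im d Im_le_Cmod) as H.
  specialize (H ltac:(intros; unfold Cminus; now rewrite im_plus, im_opp)).
  revert H. apply bigO_ext; [typeclasses eauto|].
  apply filter_forall. intros nu. unfold bessel_im. fold d.
  set (S := Series _). simpl sum_f_R0. generalize (/ nu). intros t. unfold exp_coef, Cpoly. simpl. field.
Qed.

(** * The phase of the Bessel function *)

(** Iterated, this gives Taylor remainders from the mean value theorem alone. *)
Lemma derive_power_bound (f df : R -> R) (K a y : R) (n : nat) :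
  f 0 = 0 -> 0 <= K -> Rabs y <= a ->
  (forall c, Rabs c <= a -> is_derive f c (df c) /\ Rabs (df c) <= K * Rabs c ^ n) ->
  Rabs (f y) <= K * Rabs y ^ S n.
Proof.
  intros H0 HK Hy Hd.
  destruct (MVT_cor4 f df 0 (Rabs y)) with (b := y) as [c [Hc Hcy]].
  - intros c Hc. rewrite Rminus_0_r in Hc. apply Hd. lra.
  - rewrite Rminus_0_r. lra.
  - rewrite H0, !Rminus_0_r in *. rewrite Hc, Rabs_mult, <- tech_pow_Rmult, (Rmult_comm (Rabs y)).
    rewrite <- Rmult_assoc. apply Rmult_le_compat_r; [apply Rabs_pos|].
    apply Rle_trans with (1 := proj2 (Hd c ltac:(lra))).
    apply Rmult_le_compat_l; [exact HK|]. apply pow_incr. split; [apply Rabs_pos|exact Hcy].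
Qed.

Lemma is_derive_atan_pow (c : R) : is_derive atan c (/ (1 + c ^ 2)).
Proof. apply is_derive_Reals. apply derivable_pt_lim_atan. Qed.

Lemma atan_taylor (y : R) : Rabs (atan y - (y - y ^ 3 / 3 + y ^ 5 / 5)) <= 1 * Rabs y ^ 7.
Proof.
  apply (derive_power_bound (fun y => atan y - (y - y ^ 3 / 3 + y ^ 5 / 5))
     (fun c => - (c ^ 6 / (1 + c ^ 2))) 1 (Rabs y)); [|lra|lra|].
  - rewrite atan_0. field.
  - intros c _. split.
    + auto_derive; [trivial|]. simpl. field. nra.
    + rewrite Rabs_Ropp, Rmult_1_l, RPow_abs. unfold Rdiv. rewrite Rabs_mult.
      rewrite <- (Rmult_1_r (Rabs (c ^ 6))) at 2. apply Rmult_le_compat_l; [apply Rabs_pos|].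
      rewrite Rabs_pos_eq by (left; apply Rinv_0_lt_compat; nra).
      rewrite <- Rinv_1. apply Rinv_le_contravar; nra.
Qed.

Lemma atan_lipschitz (a b : R) : Rabs (atan b - atan a) <= Rabs (b - a).
Proof.
  destruct (MVT_gen atan a b (fun c => / (1 + c ^ 2))) as [c [_ Hc]].
  - intros; apply is_derive_atan_pow.
  - intros z _. apply derivable_continuous_pt, derivable_pt_atan.
  - rewrite Hc, Rabs_mult. rewrite <- (Rmult_1_l (Rabs (b - a))) at 2.
    apply Rmult_le_compat_r; [apply Rabs_pos|].
    rewrite Rabs_pos_eq by (left; apply Rinv_0_lt_compat; nra).
    rewrite <- Rinv_1. apply Rinv_le_contravar; nra.
Qed.

(** The argument of the power series, whose real part is positive for large [nu]. *)
Definition bessel_arg (x nu : R) : R := atan (bessel_im x nu / bessel_re x nu).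

Lemma filterlim_inv_at_infinity : filterlim (fun nu => / nu) at_infinity (locally 0).
Proof.
  pose proof (is_lim_inv (fun y => y) p_infty p_infty (is_lim_id p_infty) ltac:(discriminate)) as H.
  exact H.
Qed.

Lemma bessel_re_large (x : R) : at_infinity (fun nu => 1 / 2 <= bessel_re x nu).
Proof.
  pose proof (bessel_re_expand x) as H. cbv zeta in H. set (d := - (x ^ 2 / 4)) in *.
  pose proof scale_inv as Hs.
  assert (H1 : bigO at_infinity (fun nu => / nu) 1 (fun nu => bessel_re x nu - 1)).
  { apply bigO_ext with (f := fun nu =>
      (bessel_re x nu - (1 - Cpoly 2 d * (/ nu) ^ 2 + Cpoly 4 d * (/ nu) ^ 4))
      + (/ nu) ^ 1 * (- Cpoly 2 d * / nu + Cpoly 4 d * (/ nu) ^ 3)); [typeclasses eauto| |].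
    - apply filter_forall. intros nu. ring.
    - apply bigO_plus; [typeclasses eauto| |].
      + revert H. apply bigO_weaken; [typeclasses eauto|exact Hs|lia].
      + apply bigO_factor; [typeclasses eauto|exact Hs|]. bounded. }
  generalize (bigO_small _ _ _ filterlim_inv_at_infinity Hs H1 (1 / 2) ltac:(lra)).
  apply filter_imp. intros nu Hn. apply Rabs_lt_between in Hn. lra.
Qed.

(** With [t = 1 / nu], the tangent of the argument is [- t W] up to [O(t ^ 7)], where [W] is the
    even polynomial for which the real part times [- t W] matches the imaginary part; the
    arctangent series does the rest.  The coefficients are those of [log (sum a_k s ^ k)] with
    [s = - i t], whose odd terms are imaginary. *)
Lemma bessel_arg_expand (x : R) :
  let d := - (x ^ 2 / 4) in
  let a k := Cpoly k d in
  bigO at_infinity (fun nu => / nu) 7 (fun nu => bessel_arg x nu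
    + (a 1%nat * / nu
       + (a 1%nat * a 2%nat - a 3%nat - 1 / 3 * a 1%nat ^ 3) * (/ nu) ^ 3
       + (a 1%nat * a 2%nat ^ 2 + a 1%nat ^ 2 * a 3%nat - a 1%nat ^ 3 * a 2%nat
          - a 2%nat * a 3%nat - a 1%nat * a 4%nat + a 5%nat + 1 / 5 * a 1%nat ^ 5) * (/ nu) ^ 5)).
Proof.
  intros d a.
  pose proof scale_inv as Hs.
  pose proof (bessel_re_expand x) as HR. cbv zeta in HR. fold d in HR.
  pose proof (bessel_im_expand x) as HI. cbv zeta in HI. fold d in HI.
  change (Cpoly 2 d) with (a 2%nat) in HR. change (Cpoly 4 d) with (a 4%nat) in HR.
  change (Cpoly 1 d) with (a 1%nat) in HI. change (Cpoly 3 d) with (a 3%nat) in HI.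
  change (Cpoly 5 d) with (a 5%nat) in HI.
  set (a1 := a 1%nat) in *. set (a2 := a 2%nat) in *. set (a3 := a 3%nat) in *.
  set (a4 := a 4%nat) in *. set (a5 := a 5%nat) in *. clearbody a1 a2 a3 a4 a5. clear a.
  (* [a1 t + d3 t^3 + d5 t^5] is minus the quotient of the imaginary by the real part, mod [t^7]. *)
  set (d3 := - a3 + a1 * a2). set (d5 := a5 - a1 * a4 + a2 * d3).
  set (W := fun nu : R => a1 + d3 * (/ nu) ^ 2 + d5 * (/ nu) ^ 4).
  assert (BW : bigO at_infinity (fun nu => / nu) 0 W) by (unfold W; bounded).
  assert (Bw : bigO at_infinity (fun nu => / nu) 1 (fun nu => - (/ nu * W nu))).
  { apply bigO_opp; [typeclasses eauto|].
    apply bigO_ext with (f := fun nu => (/ nu) ^ 1 * W nu); [typeclasses eauto| |].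
    - apply filter_forall. intros nu. ring.
    - apply bigO_factor; [typeclasses eauto|exact Hs|exact BW]. }
  assert (H1 : bigO at_infinity (fun nu => / nu) 7
     (fun nu => bessel_im x nu - (- (/ nu * W nu)) * bessel_re x nu)).
  { apply bigO_ext with (f := fun nu =>
      (bessel_im x nu - (- (a1 * / nu) + a3 * (/ nu) ^ 3 - a5 * (/ nu) ^ 5))
      - (- (/ nu * W nu)) * (bessel_re x nu - (1 - a2 * (/ nu) ^ 2 + a4 * (/ nu) ^ 4))
      + (/ nu) ^ 7 * (d3 * a4 - d5 * a2 + d5 * a4 * (/ nu) ^ 2)); [typeclasses eauto| |].
    - apply filter_forall. intros nu. unfold W, d5, d3. ring.
    - apply bigO_plus; [typeclasses eauto| |].
      + apply bigO_minus; [typeclasses eauto|exact HI|].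
        apply (bigO_mult _ _ 1 6); assumption.
      + apply bigO_factor; [typeclasses eauto|exact Hs|]. bounded. }
  assert (H2 : bigO at_infinity (fun nu => / nu) 7
     (fun nu => bessel_arg x nu - atan (- (/ nu * W nu)))).
  { apply bigO_le with (f := fun nu => 2 * (bessel_im x nu - (- (/ nu * W nu)) * bessel_re x nu)); [typeclasses eauto| |].
    - generalize (bessel_re_large x). apply filter_imp. intros nu Hu.
      unfold bessel_arg. apply Rle_trans with (1 := atan_lipschitz _ _).
      set (w := - (/ nu * W nu)). set (u := bessel_re x nu) in *. set (v := bessel_im x nu).
      replace (v / u - w) with ((v - w * u) * / u) by (field; lra).
      rewrite !Rabs_mult, (Rmult_comm (Rabs 2)). apply Rmult_le_compat_l; [apply Rabs_pos|].
      rewrite !Rabs_pos_eq; [|lra|left; apply Rinv_0_lt_compat; lra].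
      replace 2 with (/ (1 / 2)) by field. apply Rinv_le_contravar; lra.
    - apply bigO_mult_bounded; [typeclasses eauto|bounded|exact H1]. }
  set (P := fun w : R => w - w ^ 3 / 3 + w ^ 5 / 5).
  assert (H3 : bigO at_infinity (fun nu => / nu) 7
     (fun nu => atan (- (/ nu * W nu)) - P (- (/ nu * W nu)))).
  { destruct (bigO_nonneg _ _ _ _ Hs Bw) as [M [M0 HM]].
    exists (M ^ 7). generalize (filter_and _ _ Hs HM). apply filter_imp. intros nu [Ht Hb].
    apply Rle_trans with (1 := atan_taylor _). rewrite Rmult_1_l, <- Rpow_mult_distr.
    rewrite pow_1 in Hb. apply pow_incr. split; [apply Rabs_pos|exact Hb]. }
  (* [W = a1 + t^2 E]; the multiple of [t^7] below is what [P] leaves beyond [t^5]. *)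
  set (E := fun nu : R => d3 + d5 * (/ nu) ^ 2).
  assert (BE : bigO at_infinity (fun nu => / nu) 0 E) by (unfold E; bounded).
  apply bigO_ext with (f := fun nu =>
    (bessel_arg x nu - atan (- (/ nu * W nu))) + (atan (- (/ nu * W nu)) - P (- (/ nu * W nu)))
    + (/ nu) ^ 7 * (1 / 3 * (3 * a1 ^ 2 * d5 + 3 * a1 * E nu ^ 2 + (/ nu) ^ 2 * E nu ^ 3)
       - 1 / 5 * (E nu * (W nu ^ 4 + W nu ^ 3 * a1 + W nu ^ 2 * a1 ^ 2 + W nu * a1 ^ 3 + a1 ^ 4))));
    [typeclasses eauto| |].
  - apply filter_forall. intros nu. generalize (atan (- (/ nu * W nu))), (bessel_arg x nu). intros A B.
    unfold P, W, E, d5, d3. generalize (/ nu). intros t. field.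
  - apply bigO_plus; [typeclasses eauto| |].
    + apply bigO_plus; [typeclasses eauto|exact H2|exact H3].
    + apply bigO_factor; [typeclasses eauto|exact Hs|]. bounded.
Qed.

(** [J] of order [i nu] is a positive multiple of [exp (- i bessel_phase)]. *)
Definition bessel_phase (x nu : R) : R :=
  gamma_phase nu - nu * ln (x / 2) - bessel_arg x nu.

(** The coefficients of the phase are those of the logarithm of a product, so the series
    [- s/12 + s^3/360 - s^5/1260 + ...] contributed by [1 / Gamma] separates from the terms
    contributed by the power series. *)
Lemma A_coefficients (x : R) :
  let a k := Cpoly k (- (x ^ 2 / 4)) in
  A0 x = a 1%nat - 1 / 12 /\
  A1 x = a 1%nat * a 2%nat - a 3%nat - 1 / 3 * a 1%nat ^ 3 - 1 / 360 /\
  A2 x = a 1%nat * a 2%nat ^ 2 + a 1%nat ^ 2 * a 3%nat - a 1%nat ^ 3 * a 2%nat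
          - a 2%nat * a 3%nat - a 1%nat * a 4%nat + a 5%nat + 1 / 5 * a 1%nat ^ 5 - 1 / 1260.
Proof.
  intros a.
  assert (H : forall k, ahat x k = a k + sum_n_m (fun r => stirling_gamma r * a (k - r)%nat) 1 k)
    by reflexivity.
  unfold A0, A1, A2. rewrite !H. unfold sum_n_m, Iter.iter_nat, Iter.iter, Nat.sub. simpl.
  unfold plus, zero; simpl. unfold a, Cpoly, stirling_gamma. repeat split; field.
Qed.

(** The phases of [1 / Gamma (1 + i nu)], of [(x/2) ^ (i nu)] and of the power series add up; the
    terms [nu ln nu - nu - nu ln (x/2) + PI/4] are [Phi]. *)
Lemma bessel_phase_expand (x : R) : 0 < x ->
  bigO at_infinity (fun nu => / nu) 7 (fun nu => bessel_phase x nu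
    - (Phi x nu + A0 x * / nu + A1 x * (/ nu) ^ 3 + A2 x * (/ nu) ^ 5)).
Proof.
  intros Hx. pose proof (bessel_arg_expand x) as HA. cbv zeta in HA.
  destruct (A_coefficients x) as [E0 [E1 E2]]. rewrite E0, E1, E2. clear E0 E1 E2.
  assert (HG : bigO at_infinity (fun nu => / nu) 7 (fun nu => gamma_phase nu -
    (PI / 4 + nu * ln nu - nu - 1 / (12 * nu) - 1 / (360 * nu ^ 3) - 1 / (1260 * nu ^ 5)))).
  { exists 15120. exists 1. intros nu Hnu. rewrite pow_inv. apply gamma_phase_lim. lra. }
  generalize (bigO_minus _ _ _ _ _ HG HA). apply bigO_ext; [typeclasses eauto|].
  exists 0. intros nu Hnu. unfold bessel_phase, Phi, lambda.
  replace (2 / (exp 1 * x) * nu) with (nu * / (x / 2) * exp (- 1)).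
  2: { replace (exp (-1)) with (/ exp 1) by (rewrite <- exp_Ropp; f_equal; lra).
       field. split; [lra|]. apply Rgt_not_eq, exp_pos. }
  assert (0 < / (x / 2)) by (apply Rinv_0_lt_compat; lra).
  rewrite ln_mult, ln_mult, ln_exp, ln_Rinv; [|lra|lra|lra|nra|apply exp_pos].
  generalize (bessel_arg x nu), (gamma_phase nu), (ln nu), (ln (x / 2)), PI. intros.
  generalize (Cpoly 1 (- (x ^ 2 / 4))), (Cpoly 2 (- (x ^ 2 / 4))), (Cpoly 3 (- (x ^ 2 / 4))),
   (Cpoly 4 (- (x ^ 2 / 4))), (Cpoly 5 (- (x ^ 2 / 4))). intros.
  field. lra.
Qed.

Lemma RCpower_imaginary (y nu : R) : RCpower y (Ci * nu) = cis (nu * ln y).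
Proof.
  unfold RCpower, Cexp, cis, Ci, Cmult, RtoC; simpl.
  replace (ln y * (0 * nu - 1 * 0) - 0 * (0 * 0 + 1 * nu)) with 0 by ring.
  replace (ln y * (0 * 0 + 1 * nu) + 0 * (0 * nu - 1 * 0)) with (nu * ln y) by ring.
  rewrite exp_0. apply injective_projections; simpl; ring.
Qed.

Lemma CSeries_eq (a : nat -> C) :
  CSeries a = (Series (fun k => Re (a k)), Series (fun k => Im (a k))).
Proof.
  unfold CSeries, Clim_seq, Series.
  rewrite (Lim_seq_ext (fun n => Re (sum_n a n)) (sum_n (fun k => Re (a k)))).
  - rewrite (Lim_seq_ext (fun n => Im (sum_n a n)) (sum_n (fun k => Im (a k)))); [reflexivity|].
    intros n. induction n as [|n IH]; [now rewrite !sum_O|].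
    rewrite !sum_Sn, <- IH. reflexivity.
  - intros n. induction n as [|n IH]; [now rewrite !sum_O|].
    rewrite !sum_Sn, <- IH. reflexivity.
Qed.

Lemma BesselJ_series (x nu : R) : 1 <= nu ->
  CSeries (fun k => (-1) ^ k * (x / 2) ^ (2 * k) /
                     (INR (fact k) * pochhammer (1 + Ci * nu) k))%C
  = (bessel_re x nu, bessel_im x nu).
Proof.
  intros Hnu. rewrite CSeries_eq.
  assert (E : forall k, ((-1) ^ k * (x / 2) ^ (2 * k) /
                     (INR (fact k) * pochhammer (1 + Ci * nu) k))%C
     = (RtoC (exp_coef (- (x ^ 2 / 4)) k) * / rising nu k)%C).
  { intros k. rewrite pochhammer_rising by exact Hnu.
    assert (Hf : RtoC (INR (fact k)) <> 0).
    { intros H. apply RtoC_inj in H. revert H. apply INR_fact_neq_0. }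
    pose proof (rising_neq0 nu k) as Hr.
    unfold exp_coef. rewrite RtoC_div by apply INR_fact_neq_0.
    replace (- (x ^ 2 / 4)) with ((-1) * (x / 2) ^ 2) by field.
    rewrite Rpow_mult_distr, <- pow_mult, RtoC_mult, !RtoC_pow, RtoC_div by lra.
    field. auto. }
  unfold bessel_re, bessel_im. f_equal; apply Series_ext; intros k; rewrite E.
  - apply re_scal_l.
  - apply im_scal_l.
Qed.

Lemma BesselJ_polar (x nu : R) : 1 <= nu -> 1 / 2 <= bessel_re x nu ->
  exists r, 0 < r /\ BesselJ (Ci * nu) x = (RtoC r * cis (- bessel_phase x nu))%C.
Proof.
  intros Hnu Hu. destruct (gamma_polar nu Hnu) as [g [Hg HG]].
  set (s := sqrt (bessel_re x nu ^ 2 + bessel_im x nu ^ 2)).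
  assert (Hs : 0 < s) by (apply sqrt_lt_R0; nra).
  exists (s / g). split; [apply Rdiv_lt_0_compat; lra|].
  unfold BesselJ. rewrite BesselJ_series, RCpower_imaginary by exact Hnu.
  unfold CGamma. fold (gamma_seq (1 + Ci * nu)). rewrite (is_Clim_unique _ _ HG).
  rewrite polar_atan by lra. fold s. fold (bessel_arg x nu).
  replace (- bessel_phase x nu) with (nu * ln (x / 2) + - gamma_phase nu + bessel_arg x nu)
    by (unfold bessel_phase; ring).
  rewrite !cis_plus, <- cis_inv, RtoC_div by lra. field.
  split; [apply cis_neq0|]. intros E. apply RtoC_inj in E. lra.
Qed.

Lemma bessel_bounded (x nu : R) : 1 <= nu ->
  Rabs (bessel_re x nu) <= exp (Rabs (- (x ^ 2 / 4))) /\
  Rabs (bessel_im x nu) <= exp (Rabs (- (x ^ 2 / 4))).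
Proof.
  intros Hnu. rewrite <- (Rmult_1_l (exp _)).
  split; apply (Series_weight_le _ _ _ 1 (exp_coef_abs_series (- (x ^ 2 / 4)))); intros k.
  - apply Rle_trans with (1 := re_le_Cmod _). apply (Cmod_inv_rising_le nu k 0); [exact Hnu|lia].
  - apply Rle_trans with (1 := Im_le_Cmod _). apply (Cmod_inv_rising_le nu k 0); [exact Hnu|lia].
Qed.

Lemma bessel_arg_lipschitz (x : R) : exists L, 0 <= L /\ forall a b, 1 <= a -> 1 <= b ->
  1 / 2 <= bessel_re x a -> 1 / 2 <= bessel_re x b ->
  Rabs (bessel_arg x b - bessel_arg x a) <= L * Rabs (b - a).
Proof.
  set (K := exp (Rabs (- (x ^ 2 / 4)))). set (Q := exp (Rabs (2 * - (x ^ 2 / 4)))).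
  assert (K0 : 0 < K) by apply exp_pos. assert (Q0 : 0 < Q) by apply exp_pos.
  exists (4 * (2 * K * Q)). split; [nra|]. intros a b Ha Hb Ua Ub.
  destruct (bessel_bounded x a Ha) as [B1 B2]. destruct (bessel_bounded x b Hb) as [B3 B4].
  destruct (bessel_lipschitz x b a Hb Ha) as [L1 L2]. fold K in B1, B2, B3, B4. fold Q in L1, L2.
  unfold bessel_arg. apply Rle_trans with (1 := atan_lipschitz _ _).
  set (ua := bessel_re x a) in *. set (ub := bessel_re x b) in *.
  set (va := bessel_im x a) in *. set (vb := bessel_im x b) in *.
  replace (vb / ub - va / ua) with ((/ ub * / ua) * ((vb - va) * ua - va * (ub - ua))) by (field; lra).
  rewrite Rabs_mult, Rmult_assoc.
  assert (Hi : forall u, 1 / 2 <= u -> 0 < / u <= 2).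
  { intros u Hu. split; [apply Rinv_0_lt_compat; lra|]. replace 2 with (/ (1 / 2)) by field.
    apply Rinv_le_contravar; lra. }
  pose proof (Hi _ Ua). pose proof (Hi _ Ub).
  apply Rmult_le_compat; try apply Rabs_pos.
  - rewrite Rabs_pos_eq by nra. nra.
  - unfold Rminus at 1. apply Rle_trans with (1 := Rabs_triang _ _). rewrite Rabs_Ropp, !Rabs_mult.
    pose proof (Rabs_pos (b - a)).
    assert (Rabs (vb - va) * Rabs ua <= (Q * Rabs (b - a)) * K)
      by (apply Rmult_le_compat; auto using Rabs_pos).
    assert (Rabs va * Rabs (ub - ua) <= K * (Q * Rabs (b - a)))
      by (apply Rmult_le_compat; auto using Rabs_pos).
    lra.
Qed.

(** Monotonicity makes the zeros simple to label, and continuity makes them exist.  Both come from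
    two-sided bounds on increments: [ln nu] from [Gamma] beats the Lipschitz constant of the
    power series and [ln (x/2)]. *)
Lemma bessel_phase_monotone (x : R) : exists N, 1 <= N /\
  (forall nu, N <= nu -> 1 / 2 <= bessel_re x nu) /\
  (forall a b, N <= a -> a < b -> bessel_phase x a < bessel_phase x b) /\
  (forall nu, N < nu -> continuity_pt (bessel_phase x) nu).
Proof.
  destruct (bessel_re_large x) as [N0 HN0].
  destruct (bessel_arg_lipschitz x) as [L [L0 HL]].
  set (N := Rmax (Rmax 1 (N0 + 1)) (exp (4 + ln (x / 2) + L))).
  assert (H1 : 1 <= N) by (apply Rle_trans with (2 := Rmax_l _ _); apply Rmax_l).
  assert (H2 : N0 + 1 <= N) by (apply Rle_trans with (2 := Rmax_l _ _); apply Rmax_r).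
  assert (H3 : exp (4 + ln (x / 2) + L) <= N) by apply Rmax_r.
  clearbody N.
  assert (HR : forall nu, N <= nu -> 1 / 2 <= bessel_re x nu) by (intros nu Hnu; apply HN0; lra).
  assert (Hinc : forall a b, N <= a -> a < b ->
    b - a <= bessel_phase x b - bessel_phase x a <= (ln b + 3 + Rabs (ln (x / 2)) + L) * (b - a)).
  { intros a b Ha Hab.
    pose proof (gamma_phase_increment a b ltac:(lra) Hab) as [G1 G2].
    specialize (HL a b ltac:(lra) ltac:(lra) (HR a Ha) (HR b ltac:(lra))).
    rewrite (Rabs_pos_eq (b - a)) in HL by lra. apply Rabs_le_between in HL.
    assert (Hln : 4 + ln (x / 2) + L <= ln a).
    { rewrite <- (ln_exp (4 + ln (x / 2) + L)). apply ln_le; [apply exp_pos|lra]. }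
    assert (Hl2 : - (Rabs (ln (x / 2)) * (b - a)) <= ln (x / 2) * (b - a)).
    { pose proof (Rle_abs (- ln (x / 2))) as Hq. rewrite Rabs_Ropp in Hq. nra. }
    unfold bessel_phase. split; nra. }
  exists N. split; [exact H1|]. split; [exact HR|]. split.
  - intros a b Ha Hab. specialize (Hinc a b Ha Hab). lra.
  - intros nu Hnu. set (K := ln (nu + 1) + 3 + Rabs (ln (x / 2)) + L).
    assert (K0 : 0 < K).
    { unfold K. assert (0 <= ln (nu + 1)) by (rewrite <- ln_1; apply ln_le; lra).
      pose proof (Rabs_pos (ln (x / 2))). lra. }
    intros e He. exists (Rmin (Rmin 1 (nu - N)) (e / K)).
    assert (HeK : 0 < e / K) by (apply Rdiv_lt_0_compat; lra).
    split; [repeat apply Rmin_pos; lra|].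
    intros y [_ Hy]. simpl in Hy. unfold Rdist in Hy. simpl. unfold Rdist.
    assert (Y1 : Rabs (y - nu) < 1) by (apply Rlt_le_trans with (1 := Hy); apply Rle_trans with (1 := Rmin_l _ _); apply Rmin_l).
    assert (Y2 : Rabs (y - nu) < nu - N) by (apply Rlt_le_trans with (1 := Hy); apply Rle_trans with (1 := Rmin_l _ _); apply Rmin_r).
    assert (Y3 : Rabs (y - nu) < e / K) by (apply Rlt_le_trans with (1 := Hy); apply Rmin_r).
    assert (HK : Rabs (bessel_phase x y - bessel_phase x nu) <= K * Rabs (y - nu)).
    { apply Rabs_lt_between in Y1. apply Rabs_lt_between in Y2.
      destruct (Rtotal_order y nu) as [Hlt|[->|Hgt]].
      - destruct (Hinc y nu ltac:(lra) Hlt) as [I1 I2].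
        assert (ln nu <= ln (nu + 1)) by (apply ln_le; lra).
        rewrite (Rabs_minus_sym (bessel_phase x y)), (Rabs_minus_sym y), !Rabs_pos_eq by lra.
        apply Rle_trans with (1 := I2). apply Rmult_le_compat_r; [lra|unfold K; lra].
      - rewrite !Rminus_diag, Rabs_R0. lra.
      - destruct (Hinc nu y ltac:(lra) Hgt) as [I1 I2].
        assert (ln y <= ln (nu + 1)) by (apply ln_le; lra).
        rewrite !Rabs_pos_eq by lra.
        apply Rle_trans with (1 := I2). apply Rmult_le_compat_r; [lra|unfold K; lra]. }
    apply Rle_lt_trans with (1 := HK).
    apply Rlt_le_trans with (K * (e / K)); [apply Rmult_lt_compat_l; lra|].
    right. field. lra.
Qed.

(** * Zeros and their labels *)

Lemma Clim_seq_conj (u : nat -> C) : Clim_seq (fun n => Cconj (u n)) = Cconj (Clim_seq u).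
Proof.
  unfold Clim_seq, Cconj; simpl. f_equal.
  rewrite Lim_seq_opp. now destruct (Lim_seq _); simpl; rewrite ?Ropp_0.
Qed.

Lemma Cconj_inv (z : C) : Cconj (/ z) = (/ Cconj z)%C.
Proof.
  unfold Cconj, Cinv; simpl. apply injective_projections; simpl.
  - f_equal. ring.
  - replace (- snd z * (- snd z * 1)) with (snd z * (snd z * 1)) by ring.
    unfold Rdiv. ring.
Qed.

Lemma Cconj_div (y z : C) : Cconj (y / z) = (Cconj y / Cconj z)%C.
Proof. unfold Cdiv. now rewrite Cmult_conj, Cconj_inv. Qed.

Lemma Cconj_RtoC (r : R) : Cconj r = r.
Proof. unfold Cconj, RtoC; simpl. now rewrite Ropp_0. Qed.

Lemma RCpower_conj (y : R) (z : C) : RCpower y (Cconj z) = Cconj (RCpower y z).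
Proof.
  unfold RCpower, Cexp, Cconj, Cmult, RtoC; simpl.
  replace (ln y * fst z - 0 * - snd z) with (ln y * fst z - 0 * snd z) by ring.
  replace (ln y * - snd z + 0 * fst z) with (- (ln y * snd z + 0 * fst z)) by ring.
  rewrite cos_neg, sin_neg. apply injective_projections; simpl; ring.
Qed.

Lemma Cshift_prod_conj (z : C) (n : nat) : Cshift_prod (Cconj z) n = Cconj (Cshift_prod z n).
Proof.
  induction n as [|n IH]; [reflexivity|].
  change (Cshift_prod (Cconj z) (S n)) with (Cshift_prod (Cconj z) n * (Cconj z + INR (S n)))%C.
  change (Cshift_prod z (S n)) with (Cshift_prod z n * (z + INR (S n)))%C.
  now rewrite Cmult_conj, Cplus_conj, Cconj_RtoC, IH.
Qed.

Lemma Clim_seq_ext (u v : nat -> C) : (forall n, u n = v n) -> Clim_seq u = Clim_seq v.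
Proof.
  intros H. unfold Clim_seq.
  rewrite (Lim_seq_ext (fun n => Re (u n)) (fun n => Re (v n))) by (intros; now rewrite H).
  rewrite (Lim_seq_ext (fun n => Im (u n)) (fun n => Im (v n))) by (intros; now rewrite H).
  reflexivity.
Qed.

Lemma CGamma_conj (z : C) : CGamma (Cconj z) = Cconj (CGamma z).
Proof.
  unfold CGamma. rewrite <- Clim_seq_conj. apply Clim_seq_ext. intros n.
  now rewrite Cconj_div, Cmult_conj, Cconj_RtoC, RCpower_conj, Cshift_prod_conj.
Qed.

Lemma sum_n_conj (a : nat -> C) (n : nat) : sum_n (fun k => Cconj (a k)) n = Cconj (sum_n a n).
Proof.
  induction n as [|n IH]; [now rewrite !sum_O|].
  rewrite !sum_Sn, IH. symmetry. exact (Cplus_conj (sum_n a n) (a (S n))).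
Qed.

(** Every ingredient commutes with conjugation, whether or not the limits exist. *)
Lemma BesselJ_conj (mu : C) (x : R) : BesselJ (Cconj mu) x = Cconj (BesselJ mu x).
Proof.
  unfold BesselJ.
  assert (E1 : (1 + Cconj mu)%C = Cconj (1 + mu)) by now rewrite Cplus_conj, Cconj_RtoC.
  rewrite Cmult_conj, Cconj_div, E1, CGamma_conj, RCpower_conj. f_equal.
  unfold CSeries. rewrite <- Clim_seq_conj. apply Clim_seq_ext. intros n.
  rewrite <- sum_n_conj. apply sum_n_ext. intros k.
  assert (E2 : pochhammer (Cconj (1 + mu)) k = Cconj (pochhammer (1 + mu) k)).
  { unfold pochhammer. generalize (1 + mu)%C. intros z.
    now rewrite Cconj_div, <- !CGamma_conj, Cplus_conj, Cconj_RtoC. }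
  rewrite E2, Cconj_div, !Cmult_conj, !Cpow_conj, Cconj_div, !Cconj_RtoC. reflexivity.
Qed.

Lemma Cmult_eq0_r (a z : C) : a <> 0 -> (a * z)%C = 0 <-> z = 0.
Proof.
  intros Ha. split; intros H; [|rewrite H; apply Cmult_0_r].
  destruct (Ceq_dec z 0) as [E|E]; [exact E|]. now destruct (Cmult_neq_0 a z Ha E).
Qed.

Lemma RtoC_eq0 (r : R) : RtoC r = 0 <-> r = 0.
Proof. split; intros H; [now apply RtoC_inj|now rewrite H]. Qed.

(** [J + conj J] is [2 |J|] times the cosine of the phase; the cosine is written as a
    sine so that both functions take the form [sin (phase - s)]. *)
Lemma BesselF_zero (x nu : R) : 1 <= nu -> 1 / 2 <= bessel_re x nu ->
  (BesselF x nu = 0 <-> sin (bessel_phase x nu - PI / 2) = 0).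
Proof.
  intros Hnu Hu. destruct (BesselJ_polar x nu Hnu Hu) as [r [Hr HJ]].
  unfold BesselF.
  replace (- (Ci * nu))%C with (Cconj (Ci * nu)) by (apply injective_projections; simpl; ring).
  rewrite BesselJ_conj, HJ.
  set (T := bessel_phase x nu).
  replace (r * cis (- T) + Cconj (r * cis (- T)))%C with (RtoC (2 * r * cos T)).
  2: { apply injective_projections; simpl; rewrite ?cos_neg; ring. }
  rewrite Cmult_eq0_r.
  - rewrite RtoC_eq0, <- (cos_shift (T - PI / 2)).
    replace (PI / 2 - (T - PI / 2)) with (- (T - PI)) by lra.
    rewrite cos_neg. replace (cos (T - PI)) with (- cos T).
    + split; intros H; [|]; nra.
    + unfold Rminus. rewrite cos_plus, cos_neg, sin_neg, cos_PI, sin_PI. ring.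
  - assert (Hc : 0 < cosh (PI * nu / 2)).
    { unfold cosh. pose proof (exp_pos (PI * nu / 2)). pose proof (exp_pos (- (PI * nu / 2))). lra. }
    rewrite <- RtoC_mult, <- RtoC_inv by lra. rewrite RtoC_eq0.
    apply Rgt_not_eq, Rinv_0_lt_compat. lra.
Qed.

Lemma BesselG_zero (x nu : R) : 1 <= nu -> 1 / 2 <= bessel_re x nu ->
  (BesselG x nu = 0 <-> sin (bessel_phase x nu - 0) = 0).
Proof.
  intros Hnu Hu. destruct (BesselJ_polar x nu Hnu Hu) as [r [Hr HJ]].
  unfold BesselG.
  replace (- (Ci * nu))%C with (Cconj (Ci * nu)) by (apply injective_projections; simpl; ring).
  rewrite BesselJ_conj, HJ, Rminus_0_r.
  set (T := bessel_phase x nu).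
  replace (r * cis (- T) - Cconj (r * cis (- T)))%C with (2 * Ci * RtoC (- r * sin T))%C.
  2: { apply injective_projections; simpl; rewrite ?cos_neg, ?sin_neg; ring. }
  assert (Hi : (2 * Ci)%C <> 0) by (intros E; injection E; lra).
  assert (Hc : 0 < sinh (PI * nu / 2)).
  { unfold sinh. pose proof PI_RGT_0.
    assert (exp (- (PI * nu / 2)) < exp (PI * nu / 2)) by (apply exp_increasing; nra). lra. }
  assert (Hs : RtoC (sinh (PI * nu / 2)) <> 0) by (rewrite RtoC_eq0; lra).
  replace (/ (2 * Ci * sinh (PI * nu / 2)) * (2 * Ci * (- r * sin T)%R))%C
    with (/ sinh (PI * nu / 2) * (- r * sin T)%R)%C.
  - rewrite Cmult_eq0_r.
    + rewrite RtoC_eq0. split; intros H; nra.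
    + rewrite <- RtoC_inv by lra. rewrite RtoC_eq0. apply Rgt_not_eq, Rinv_0_lt_compat; lra.
  - assert (HCi : Ci <> 0) by (intros E; injection E; lra).
    field. repeat split; auto.
Qed.

Lemma lambda_pos (x : R) : 0 < x -> 0 < lambda x.
Proof.
  intros Hx. unfold lambda. pose proof (exp_pos 1). apply Rdiv_lt_0_compat; nra.
Qed.

Lemma xlnx_le (l v : R) : 0 < l -> 0 < v -> v * ln (l * v) <= l * v ^ 2.
Proof.
  intros Hl Hv. assert (Hp : 0 < l * v) by nra. pose proof (ln_le_sub (l * v) Hp). nra.
Qed.

Lemma bessel_phase_minus_Phi (x : R) : 0 < x ->
  bigO at_infinity (fun nu => / nu) 1 (fun nu => bessel_phase x nu - Phi x nu).
Proof.
  intros Hx. pose proof scale_inv as Hs.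
  apply bigO_ext with (f := fun nu =>
    (bessel_phase x nu - (Phi x nu + A0 x * / nu + A1 x * (/ nu) ^ 3 + A2 x * (/ nu) ^ 5))
    + (/ nu) ^ 1 * (A0 x + A1 x * (/ nu) ^ 2 + A2 x * (/ nu) ^ 4)); [typeclasses eauto| |].
  - apply filter_forall. intros nu. ring.
  - apply bigO_plus; [typeclasses eauto| |].
    + generalize (bessel_phase_expand x Hx). apply bigO_weaken; [typeclasses eauto|exact Hs|lia].
    + apply bigO_factor; [typeclasses eauto|exact Hs|]. bounded.
Qed.

Lemma bessel_phase_to_infinity (x : R) (M : R) : 0 < x ->
  at_infinity (fun nu => M < bessel_phase x nu).
Proof.
  intros Hx. pose proof (lambda_pos x Hx) as Hl.
  pose proof (bigO_small _ _ _ filterlim_inv_at_infinity scale_inv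
    (bessel_phase_minus_Phi x Hx) 1 ltac:(lra)) as Hs.
  assert (Hb : at_infinity (fun nu => Rmax (exp 1 / lambda x) (Rmax 0 (M + 1)) < nu))
    by (exists (Rmax (exp 1 / lambda x) (Rmax 0 (M + 1))); auto).
  generalize (filter_and _ _ Hs Hb). apply filter_imp. intros nu [H1 H2].
  apply Rabs_lt_between in H1.
  pose proof (Rmax_l (exp 1 / lambda x) (Rmax 0 (M + 1))).
  pose proof (Rmax_r (exp 1 / lambda x) (Rmax 0 (M + 1))).
  pose proof (Rmax_l 0 (M + 1)). pose proof (Rmax_r 0 (M + 1)).
  assert (He : exp 1 <= lambda x * nu).
  { apply Rmult_le_reg_r with (/ lambda x); [now apply Rinv_0_lt_compat|].
    replace (lambda x * nu * / lambda x) with nu by (field; lra). unfold Rdiv in *. lra. }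
  assert (Hln : 1 <= ln (lambda x * nu)).
  { rewrite <- (ln_exp 1). apply ln_le; [apply exp_pos|exact He]. }
  unfold Phi in H1. pose proof PI_RGT_0. nra.
Qed.

Lemma filterlim_at_infinity (nu : nat -> R) :
  (forall M, eventually (fun n => M < nu n)) -> filterlim nu eventually at_infinity.
Proof.
  intros H P [M HM]. unfold filtermap. generalize (H M). apply filter_imp. auto.
Qed.

Lemma bigO_comp {S T} (F : (T -> Prop) -> Prop) (G : (S -> Prop) -> Prop) t k (f : T -> R) (h : S -> T) :
  filterlim h G F -> bigO F t k f -> bigO G (fun n => t (h n)) k (fun n => f (h n)).
Proof. intros Hh [M HM]. exists M. exact (Hh _ HM). Qed.

Lemma bessel_phase_lim (x : R) (nu : nat -> R) : 0 < x -> filterlim nu eventually at_infinity ->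
  is_lim_seq (fun n => bessel_phase x (nu n) - Phi x (nu n)) 0.
Proof.
  intros Hx Hnu. apply is_lim_seq_spec. intros e. unfold filtermap.
  pose proof (bigO_small _ _ _ filterlim_inv_at_infinity scale_inv
    (bessel_phase_minus_Phi x Hx) e (cond_pos e)) as Hs.
  generalize (Hnu _ Hs). unfold filtermap. apply filter_imp. intros n. now rewrite Rminus_0_r.
Qed.

Lemma eventually_PI_gt (s M : R) : eventually (fun n => M < INR n * PI + s).
Proof.
  destruct (proj2 (is_lim_seq_spec _ _) is_lim_seq_INR (Rmax 0 (M - s))) as [N HN].
  exists N. intros n Hn. specialize (HN n Hn).
  pose proof (Rmax_l 0 (M - s)). pose proof (Rmax_r 0 (M - s)).
  assert (1 < PI) by (pose proof PI2_1; lra). nra.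
Qed.

(** [nu n] is the solution of [bessel_phase v = th n] beyond a threshold [T], unique by
    monotonicity, and [0] when there is none.  Taking [T] so large that the phase exceeds [s]
    rules out negative multiples of [PI]. *)
Lemma labels_zeros_exist (x s : R) (Z : R -> C) (th : nat -> R) (N : R) : 0 < x -> 1 <= N ->
  (forall n, th n = INR n * PI + s) ->
  (forall a b, N <= a -> a < b -> bessel_phase x a < bessel_phase x b) ->
  (forall nu, N < nu -> continuity_pt (bessel_phase x) nu) ->
  (forall nu, N <= nu -> (Z nu = 0 <-> sin (bessel_phase x nu - s) = 0)) ->
  exists nu, labels_zeros x Z th nu.
Proof.
  intros Hx HN Hth Hinc Hcont HZ.
  destruct (bessel_phase_to_infinity x s Hx) as [N1 HN1].
  set (T := Rmax N N1 + 1).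
  assert (TN : N < T) by (unfold T; pose proof (Rmax_l N N1); lra).
  assert (TN1 : N1 < T) by (unfold T; pose proof (Rmax_r N N1); lra).
  clearbody T.
  set (P := fun n v => T < v /\ bessel_phase x v = th n).
  set (nu := fun n => if excluded_middle_informative (exists v, P n v)
                      then epsilon (inhabits 0) (P n) else 0).
  assert (Hnu : forall n v, P n v -> nu n = v).
  { intros n v Hv. unfold nu. destruct (excluded_middle_informative _) as [He|He].
    - pose proof (epsilon_spec (inhabits 0) (P n) He) as [H1 H2]. destruct Hv as [V1 V2].
      set (w := epsilon _ _) in *.
      destruct (Rtotal_order w v) as [L|[E|G]]; [|exact E|].
      + pose proof (Hinc w v ltac:(lra) L). lra.
      + pose proof (Hinc v w ltac:(lra) G). lra.
    - destruct He. now exists v. }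
  assert (Hbig : forall M, eventually (fun n => P n (nu n) /\ M < nu n)).
  { intros M. set (M' := Rmax M T + 1).
    assert (M1 : M < M') by (unfold M'; pose proof (Rmax_l M T); lra).
    assert (M2 : T < M') by (unfold M'; pose proof (Rmax_r M T); lra).
    clearbody M'.
    generalize (eventually_PI_gt s (bessel_phase x M')). apply filter_imp. intros n Hn.
    rewrite <- Hth in Hn.
    destruct (bessel_phase_to_infinity x (th n) Hx) as [B HB].
    set (b := Rmax B M' + 1).
    assert (B1 : B < b) by (unfold b; pose proof (Rmax_l B M'); lra).
    assert (B2 : M' < b) by (unfold b; pose proof (Rmax_r B M'); lra).
    clearbody b. specialize (HB b B1).
    destruct (IVT_interv (fun v => bessel_phase x v - th n) M' b) as [v [Hv1 Hv2]]; try lra.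
    - intros a Ha. apply continuity_pt_minus.
      + apply Hcont. lra.
      + apply continuity_pt_const. intros ? ?; reflexivity.
    - assert (HP : P n v) by (split; lra).
      rewrite (Hnu n v HP). split; [exact HP|]. lra. }
  assert (Hlim : filterlim nu eventually at_infinity).
  { apply filterlim_at_infinity. intros M. generalize (Hbig M). apply filter_imp. tauto. }
  exists nu. split; [|split].
  - generalize (Hbig 0). apply filter_imp. intros n [[H1 H2] H3]. split; [exact H3|].
    apply HZ; [lra|]. rewrite H2, Hth. replace (INR n * PI + s - s) with (INR n * PI) by ring.
    rewrite INR_IZR_INZ. apply sin_eq_0_1. now exists (Z.of_nat n).
  - exists T. intros v Hv HZv. apply HZ in HZv; [|lra].
    destruct (sin_eq_0_0 _ HZv) as [k Hk].
    pose proof (HN1 v ltac:(lra)) as Hs.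
    assert (Hk0 : (0 <= k)%Z).
    { apply le_IZR. pose proof PI_RGT_0. nra. }
    assert (Hkn : IZR k = INR (Z.to_nat k)).
    { rewrite INR_IZR_INZ, Z2Nat.id by exact Hk0. reflexivity. }
    exists (Z.to_nat k). split.
    + apply Hnu. split; [exact Hv|]. rewrite Hth, <- Hkn. lra.
    + intros n Hn. unfold nu in Hn. destruct (excluded_middle_informative _) as [He|He]; [|lra].
      pose proof (epsilon_spec (inhabits 0) (P n) He) as [_ H2]. rewrite Hn, Hth in H2.
      apply INR_eq. rewrite <- Hkn. pose proof PI_RGT_0.
      apply Rmult_eq_reg_r with PI; lra.
  - apply is_lim_seq_ext_loc with (fun n => bessel_phase x (nu n) - Phi x (nu n)).
    + generalize (Hbig 0). apply filter_imp. intros n [[_ H] _]. now rewrite H.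
    + now apply bessel_phase_lim.
Qed.

(** The labelling condition fixes the phase at [nu n] only up to [o(1)], but at a zero the phase is
    [s] plus an integer multiple of [PI]; for large [n] this integer must be [n]. *)
Lemma labels_zeros_phase (x s : R) (Z : R -> C) (th nu : nat -> R) (N : R) : 0 < x ->
  (forall n, th n = INR n * PI + s) ->
  (forall v, N <= v -> (Z v = 0 <-> sin (bessel_phase x v - s) = 0)) ->
  labels_zeros x Z th nu ->
  filterlim nu eventually at_infinity /\
  eventually (fun n => bessel_phase x (nu n) = th n).
Proof.
  intros Hx Hth HZ [Hzero [_ Hlim]].
  pose proof (lambda_pos x Hx) as Hl.
  assert (Hsm : forall e, 0 < e -> eventually (fun n => Rabs (th n - Phi x (nu n)) < e)).
  { intros e He. pose proof (proj2 (is_lim_seq_spec _ _) Hlim (mkposreal e He)) as H.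
    revert H. apply filter_imp. intros n. now rewrite Rminus_0_r. }
  assert (Hinf : filterlim nu eventually at_infinity).
  { apply filterlim_at_infinity. intros M.
    generalize (filter_and _ _ Hzero (filter_and _ _ (Hsm 1 Rlt_0_1)
      (eventually_PI_gt s (lambda x * Rmax 0 M ^ 2 + PI / 4 + 1)))). apply filter_imp.
    intros n [[Hp _] [H1 H2]]. rewrite <- Hth in H2. apply Rabs_lt_between in H1.
    destruct (Rlt_le_dec M (nu n)) as [Hlt|Hle]; [exact Hlt|exfalso].
    pose proof (xlnx_le _ _ Hl Hp) as H3. unfold Phi in H1.
    assert (nu n ^ 2 <= Rmax 0 M ^ 2).
    { apply pow_incr. split; [lra|]. apply Rle_trans with (1 := Hle). apply Rmax_r. }
    assert (lambda x * nu n ^ 2 <= lambda x * Rmax 0 M ^ 2) by (apply Rmult_le_compat_l; lra).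
    lra. }
  split; [exact Hinf|].
  pose proof (bessel_phase_lim x nu Hx Hinf) as Hp.
  pose proof (proj2 (is_lim_seq_spec _ _) Hp (mkposreal 1 Rlt_0_1)) as Hp1. simpl in Hp1.
  assert (HN : eventually (fun n => N < nu n)).
  { apply (Hinf (fun v => N < v)). exists N. auto. }
  generalize (filter_and _ _ Hzero (filter_and _ _ HN (filter_and _ _ (Hsm 1 Rlt_0_1) Hp1))).
  apply filter_imp. intros n [[_ Hz] [Hn [H1 H2]]].
  rewrite Rminus_0_r in H2. apply Rabs_lt_between in H1. apply Rabs_lt_between in H2.
  apply HZ in Hz; [|lra]. destruct (sin_eq_0_0 _ Hz) as [k Hk].
  rewrite Hth in *.
  assert (E : k = Z.of_nat n).
  { assert (2 < PI) by (pose proof PI2_1; pose proof PI2_3_2; lra).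
    assert (-1 < k - Z.of_nat n < 1)%Z; [|lia].
    split; apply lt_IZR; rewrite minus_IZR, <- INR_IZR_INZ; nra. }
  rewrite E, <- INR_IZR_INZ in Hk. lra.
Qed.

(** * Inversion of the phase equation *)

Lemma LambertW_spec (z : R) : 0 < z -> 0 < LambertW z /\ LambertW z * exp (LambertW z) = z.
Proof.
  intros Hz. apply (epsilon_spec (inhabits 0) (fun w => 0 < w /\ w * exp w = z)).
  destruct (IVT_interv (fun w => w * exp w - z) 0 (z + 1)) as [w [Hw1 Hw2]].
  - intros a _. apply derivable_continuous_pt. exists (1 * exp a + a * exp a - 0).
    apply is_derive_Reals. auto_derive; [trivial|]. ring.
  - lra.
  - lra.
  - pose proof (exp_ineq1_le (z + 1)). nra.
  - exists w. split; [|lra]. destruct (Req_dec w 0) as [->|]; lra.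
Qed.

Lemma xi_spec (x m : R) : 0 < x -> 0 < m ->
  0 < xi x m /\ 0 < ln (lambda x * xi x m) /\ xi x m * ln (lambda x * xi x m) = m.
Proof.
  intros Hx Hm. pose proof (lambda_pos x Hx) as Hl.
  assert (Hz : 0 < lambda x * m) by nra.
  destruct (LambertW_spec _ Hz) as [HW1 HW2]. unfold xi. set (W := LambertW (lambda x * m)) in *.
  assert (E : lambda x * (m / W) = exp W).
  { replace (lambda x * (m / W)) with ((lambda x * m) / W) by (field; lra).
    rewrite <- HW2. field. lra. }
  rewrite E, ln_exp. split; [apply Rdiv_lt_0_compat; lra|]. split; [lra|]. field. lra.
Qed.

(** [bessel_phase - PI / 4] up to [O(v ^ -7)]: the labelled zeros solve [trunc_phase v = m] up to
    that error. *)
Definition trunc_phase (x v : R) : R :=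
  v * ln (lambda x * v) + (A0 x * / v + A1 x * (/ v) ^ 3 + A2 x * (/ v) ^ 5).

(** The derivative is [ln (lambda v) + 1 + o(1)], hence at least [1] for large [v]; so a small
    residual forces a small error in the solution. *)
Lemma trunc_phase_expanding (x : R) : 0 < x -> exists N, 0 < N /\
  forall a b, N <= a -> N <= b -> Rabs (a - b) <= Rabs (trunc_phase x a - trunc_phase x b).
Proof.
  intros Hx. pose proof (lambda_pos x Hx) as Hl. pose proof scale_inv as Hs.
  assert (Hsm : bigO at_infinity (fun v => / v) 1
     (fun v => - A0 x * (/ v) ^ 2 - 3 * A1 x * (/ v) ^ 4 - 5 * A2 x * (/ v) ^ 6)).
  { apply bigO_ext with (f := fun v =>
      (/ v) ^ 1 * (- A0 x * / v - 3 * A1 x * (/ v) ^ 3 - 5 * A2 x * (/ v) ^ 5)); [typeclasses eauto| |].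
    - apply filter_forall. intros v. ring.
    - apply bigO_factor; [typeclasses eauto|exact Hs|]. bounded. }
  destruct (bigO_small _ _ _ filterlim_inv_at_infinity Hs Hsm 1 Rlt_0_1) as [N0 HN0].
  set (N := Rmax (exp 1 / lambda x) (Rmax 0 N0) + 1).
  assert (N1 : exp 1 / lambda x <= N) by (unfold N; pose proof (Rmax_l (exp 1 / lambda x) (Rmax 0 N0)); lra).
  assert (N2 : 0 < N /\ N0 < N).
  { unfold N. pose proof (Rmax_r (exp 1 / lambda x) (Rmax 0 N0)).
    pose proof (Rmax_l 0 N0). pose proof (Rmax_r 0 N0). lra. }
  clearbody N. exists N. split; [lra|].
  assert (Hd : forall v, N <= v -> is_derive (trunc_phase x) v (ln (lambda x * v) + 1
     + (- A0 x * (/ v) ^ 2 - 3 * A1 x * (/ v) ^ 4 - 5 * A2 x * (/ v) ^ 6))).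
  { intros v Hv. assert (0 < lambda x * v) by nra. unfold trunc_phase.
    auto_derive; [repeat split; lra|]. field. lra. }
  intros a b Ha Hb.
  destruct (MVT_gen (trunc_phase x) b a (fun v => ln (lambda x * v) + 1
     + (- A0 x * (/ v) ^ 2 - 3 * A1 x * (/ v) ^ 4 - 5 * A2 x * (/ v) ^ 6))) as [c [Hc E]].
  - intros v Hv. apply Hd. pose proof (Rmin_glb _ _ _ Hb Ha). lra.
  - intros v Hv. apply derivable_continuous_pt. eexists. apply is_derive_Reals, Hd.
    pose proof (Rmin_glb _ _ _ Hb Ha). lra.
  - assert (Hc1 : N <= c) by (pose proof (Rmin_glb _ _ _ Hb Ha); lra).
    rewrite E, Rabs_mult. rewrite <- (Rmult_1_l (Rabs (a - b))) at 1.
    apply Rmult_le_compat_r; [apply Rabs_pos|].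
    apply Rle_trans with (2 := Rle_abs _).
    specialize (HN0 c ltac:(lra)). apply Rabs_lt_between in HN0.
    assert (He : exp 1 <= lambda x * c).
    { apply Rmult_le_reg_r with (/ lambda x); [now apply Rinv_0_lt_compat|].
      replace (lambda x * c * / lambda x) with c by (field; lra). unfold Rdiv in *. lra. }
    assert (1 <= ln (lambda x * c)).
    { rewrite <- (ln_exp 1). apply ln_le; [apply exp_pos|exact He]. }
    lra.
Qed.

(** The second derivative of the left-hand function is [c^2 / (1 + c)]; integrate twice. *)
Lemma xlnx_taylor (y : R) : Rabs y <= 1 / 2 ->
  Rabs ((1 + y) * ln (1 + y) - (y + y ^ 2 / 2 - y ^ 3 / 6)) <= 2 * Rabs y ^ 4.
Proof.
  intros Hy.
  assert (H1 : forall c, Rabs c <= 1 / 2 -> Rabs (ln (1 + c) - c + c ^ 2 / 2) <= 2 * Rabs c ^ 3).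
  { intros c Hc. apply (derive_power_bound (fun y => ln (1 + y) - y + y ^ 2 / 2)
      (fun c => c ^ 2 / (1 + c)) 2 (1 / 2) c 2); [|lra|exact Hc|].
    - rewrite Rplus_0_r, ln_1. field.
    - intros u Hu. apply Rabs_le_between in Hu. split.
      + auto_derive; [lra|]. field. lra.
      + rewrite RPow_abs. unfold Rdiv. rewrite Rabs_mult, Rmult_comm.
        apply Rmult_le_compat_r; [apply Rabs_pos|].
        rewrite Rabs_pos_eq by (left; apply Rinv_0_lt_compat; lra).
        replace 2 with (/ (1 / 2)) by field. apply Rinv_le_contravar; lra. }
  apply (derive_power_bound (fun y => (1 + y) * ln (1 + y) - (y + y ^ 2 / 2 - y ^ 3 / 6))
      (fun c => ln (1 + c) - c + c ^ 2 / 2) 2 (1 / 2) y 3); [|lra|exact Hy|].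
  - rewrite Rplus_0_r, ln_1. field.
  - intros c Hc. split; [|now apply H1]. apply Rabs_le_between in Hc.
    auto_derive; [lra|]. field. lra.
Qed.

(** The coefficient that continues [b0] and [b1]: [B2] is [b2 / rho ^ 5]. *)
Definition b2 (x m : R) : R :=
  (3 * A1 x * b0 x m - A0 x * (b0 x m ^ 2 - b1 x m) - A2 x - b0 x m * b1 x m
   + 1 / 6 * b0 x m ^ 3) / (1 + ln (lambda x * xi x m)).

Lemma B_eq_b (x m : R) : 0 < x -> 0 < m ->
  let t := / xi x m in
  B x m 0 / m ^ 1 = b0 x m * t /\ B x m 1 / m ^ 3 = b1 x m * t ^ 3 /\
  B x m 2 / m ^ 5 = b2 x m * t ^ 5.
Proof.
  intros Hx Hm t. destruct (xi_spec x m Hx Hm) as [H1 [H2 H3]].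
  assert (E : ln (lambda x * xi x m) = m / xi x m).
  { rewrite <- H3 at 2. field. lra. }
  unfold t, B, B0, B1, B2, b2.
  set (n1 := A0 x * b0 x m - A1 x - 1 / 2 * b0 x m ^ 2).
  assert (E1 : b1 x m = n1 / (1 + m / xi x m)) by (unfold b1; now rewrite E).
  set (n2 := 3 * A1 x * b0 x m - A0 x * (b0 x m ^ 2 - b1 x m) - A2 x - b0 x m * b1 x m
     + 1 / 6 * b0 x m ^ 3).
  rewrite E1, E. assert (E0 : b0 x m = - A0 x / (1 + m / xi x m)) by (unfold b0; now rewrite E).
  rewrite E0. clearbody n1 n2. unfold rho. set (y := xi x m) in *.
  repeat split; field; repeat split; lra.
Qed.

(** Here [t = 1 / xi], [D = 1 + ln (lambda xi)], the approximate solution is [(1 + y) / t] and [J] is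
    [1 / (1 + y)].  The recursions for [D c_k] are what makes the terms in [t], [t^3] and [t^5]
    cancel; [D] is unbounded, and they also remove it from the remainder. *)
Lemma trunc_phase_residual (t D y J c0 c1 c2 a0 a1 a2 r : R) : t <> 0 ->
  D * c0 = - a0 -> D * c1 = a0 * c0 - a1 - 1 / 2 * c0 ^ 2 ->
  D * c2 = 3 * a1 * c0 - a0 * (c0 ^ 2 - c1) - a2 - c0 * c1 + 1 / 6 * c0 ^ 3 ->
  J * (1 + y) = 1 ->
  let Y := c0 + c1 * t ^ 2 + c2 * t ^ 4 in
  let Y1 := c1 + c2 * t ^ 2 in
  y = t ^ 2 * Y ->
  / t * (y * (D - 1) + (y + y ^ 2 / 2 - y ^ 3 / 6) + r)
    + (a0 * (t * J) + a1 * (t * J) ^ 3 + a2 * (t * J) ^ 5)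
  = / t * r + t ^ 7 * (1 / 2 * (2 * c0 * c2 + Y1 ^ 2) - 1 / 6 * (Y1 * (Y ^ 2 + Y * c0 + c0 ^ 2))
      - a0 * c2 + a0 * (Y1 * (Y + c0)) - a0 * (Y ^ 3 * J) - 3 * a1 * Y1
      + a1 * (Y ^ 2 * (6 + 8 * y + 3 * y ^ 2) * J ^ 3)
      - a2 * (Y * (5 + 10 * y + 10 * y ^ 2 + 5 * y ^ 3 + y ^ 4) * J ^ 5)).
Proof.
  intros Ht H0 H1 H2 HJ Y Y1 Hy.
  assert (J1 : J = 1 - y + y ^ 2 - y ^ 3 * J).
  { transitivity ((J * (1 + y)) * (1 - y + y ^ 2) - y ^ 3 * J); [ring|]. rewrite HJ. ring. }
  assert (J3 : J ^ 3 = 1 - 3 * y + y ^ 2 * (6 + 8 * y + 3 * y ^ 2) * J ^ 3).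
  { transitivity ((J * (1 + y)) ^ 3 * (1 - 3 * y) + y ^ 2 * (6 + 8 * y + 3 * y ^ 2) * J ^ 3); [ring|].
    rewrite HJ. ring. }
  assert (J5 : J ^ 5 = 1 - y * (5 + 10 * y + 10 * y ^ 2 + 5 * y ^ 3 + y ^ 4) * J ^ 5).
  { transitivity ((J * (1 + y)) ^ 5 - y * (5 + 10 * y + 10 * y ^ 2 + 5 * y ^ 3 + y ^ 4) * J ^ 5); [ring|].
    rewrite HJ. ring. }
  assert (HD : / t * (y * D) = (- a0) * t + (a0 * c0 - a1 - 1 / 2 * c0 ^ 2) * t ^ 3
     + (3 * a1 * c0 - a0 * (c0 ^ 2 - c1) - a2 - c0 * c1 + 1 / 6 * c0 ^ 3) * t ^ 5).
  { rewrite <- H0, <- H1, <- H2, Hy. unfold Y. field. exact Ht. }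
  replace (/ t * (y * (D - 1) + (y + y ^ 2 / 2 - y ^ 3 / 6) + r))
    with (/ t * (y * D) + / t * (y ^ 2 / 2 - y ^ 3 / 6) + / t * r) by ring.
  rewrite HD, !Rpow_mult_distr.
  replace (a0 * (t * J)) with (a0 * t * J) by ring. rewrite J1 at 1.
  rewrite J3 at 1. rewrite J5 at 1.
  generalize (J ^ 3), (J ^ 5). intros K3 K5.
  rewrite Hy. unfold Y1, Y. field. exact Ht.
Qed.

(** Insert [eta = xi + b0 / xi + b1 / xi^3 + b2 / xi^5]: both [eta] and [nu] solve [trunc_phase = m] up
    to [O(xi ^ -7)], and the map is expanding.  Shorter sums follow since the [b_k] are bounded. *)
Lemma zero_expansion_of_trunc_phase (x : R) (m nu : nat -> R) : 0 < x ->
  (forall M, eventually (fun n => M < m n)) ->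
  filterlim nu eventually at_infinity ->
  eventually (fun n => m n - 1 <= nu n * ln (lambda x * nu n)) ->
  bigO eventually (fun n => / nu n) 7 (fun n => trunc_phase x (nu n) - m n) ->
  zero_expansion x m nu.
Proof.
  intros Hx Hm Hnu Hlow Hres. pose proof (lambda_pos x Hx) as Hl.
  set (X := fun n => xi x (m n)). set (t := fun n => / X n).
  set (D := fun n => 1 + ln (lambda x * X n)).
  assert (Hxi : eventually (fun n => 0 < X n /\ 1 < D n /\ X n * (D n - 1) = m n)).
  { generalize (Hm 0). apply filter_imp. intros n Hn.
    destruct (xi_spec x (m n) Hx Hn) as [H1 [H2 H3]]. unfold D, X. repeat split; lra. }
  assert (HX : filterlim X eventually at_infinity).
  { apply filterlim_at_infinity. intros M.
    generalize (filter_and _ _ Hxi (Hm (lambda x * Rmax 0 M ^ 2))). apply filter_imp.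
    intros n [[H1 [H2 H3]] H4]. destruct (Rlt_le_dec M (X n)) as [G|G]; [exact G|exfalso].
    pose proof (xlnx_le _ _ Hl H1) as H5. unfold D in H3.
    assert (X n ^ 2 <= Rmax 0 M ^ 2).
    { apply pow_incr. split; [lra|]. apply Rle_trans with (1 := G). apply Rmax_r. }
    assert (lambda x * X n ^ 2 <= lambda x * Rmax 0 M ^ 2) by (apply Rmult_le_compat_l; lra).
    lra. }
  assert (Ht : scale eventually t) by exact (HX _ scale_inv).
  assert (Htlim : filterlim t eventually (locally 0)).
  { apply filterlim_comp with (1 := HX). apply filterlim_inv_at_infinity. }
  assert (BD : bigO eventually t 0 (fun n => / D n)).
  { exists 1. generalize Hxi. apply filter_imp. intros n [_ [H _]].
    rewrite Rabs_pos_eq by (left; apply Rinv_0_lt_compat; lra). simpl. rewrite Rmult_1_r, <- Rinv_1.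
    apply Rinv_le_contravar; lra. }
  set (c0 := fun n => b0 x (m n)). set (c1 := fun n => b1 x (m n)). set (c2 := fun n => b2 x (m n)).
  assert (Bc0 : bigO eventually t 0 c0).
  { apply bigO_ext with (f := fun n => - A0 x * / D n); [typeclasses eauto| |bounded].
    apply filter_forall. reflexivity. }
  assert (Bc1 : bigO eventually t 0 c1).
  { apply bigO_ext with (f := fun n => (A0 x * c0 n - A1 x - 1 / 2 * c0 n ^ 2) * / D n);
      [typeclasses eauto| |bounded].
    apply filter_forall. reflexivity. }
  assert (Bc2 : bigO eventually t 0 c2).
  { apply bigO_ext with (f := fun n => (3 * A1 x * c0 n - A0 x * (c0 n ^ 2 - c1 n) - A2 x - c0 n * c1 n
      + 1 / 6 * c0 n ^ 3) * / D n); [typeclasses eauto| |bounded].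
    apply filter_forall. reflexivity. }
  set (Y := fun n => c0 n + c1 n * t n ^ 2 + c2 n * t n ^ 4).
  set (Y1 := fun n => c1 n + c2 n * t n ^ 2).
  set (y := fun n => t n ^ 2 * Y n).
  assert (BY : bigO eventually t 0 Y) by (unfold Y; bounded).
  assert (BY1 : bigO eventually t 0 Y1) by (unfold Y1; bounded).
  assert (By2 : bigO eventually t 2 y).
  { unfold y. apply bigO_factor; [typeclasses eauto|exact Ht|exact BY]. }
  assert (By : bigO eventually t 0 y) by (revert By2; apply bigO_weaken; [typeclasses eauto|exact Ht|lia]).
  assert (Hy : eventually (fun n => Rabs (y n) < 1 / 2)).
  { apply (bigO_small eventually t y Htlim Ht); [|lra].
    revert By2. apply bigO_weaken; [typeclasses eauto|exact Ht|lia]. }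
  set (J := fun n => / (1 + y n)).
  assert (BJ : bigO eventually t 0 J).
  { exists 2. generalize Hy. apply filter_imp. intros n H. apply Rabs_lt_between in H.
    unfold J. rewrite Rabs_pos_eq by (left; apply Rinv_0_lt_compat; lra). simpl. rewrite Rmult_1_r.
    replace 2 with (/ (1 / 2)) by field. apply Rinv_le_contravar; lra. }
  set (r := fun n => (1 + y n) * ln (1 + y n) - (y n + y n ^ 2 / 2 - y n ^ 3 / 6)).
  assert (Br : bigO eventually t 7 (fun n => / t n * r n)).
  { destruct (bigO_nonneg _ _ _ _ Ht By2) as [M [M0 HM]].
    exists (2 * M ^ 4). generalize (filter_and _ _ Ht (filter_and _ _ Hy HM)). apply filter_imp.
    intros n [T [H1 H2]]. pose proof (xlnx_taylor (y n) ltac:(lra)) as H3. fold (r n) in H3.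
    assert (H4 : Rabs (y n) ^ 4 <= (M * t n ^ 2) ^ 4) by (apply pow_incr; split; [apply Rabs_pos|exact H2]).
    assert (Ti : 0 < / t n) by (apply Rinv_0_lt_compat; lra).
    rewrite Rabs_mult, (Rabs_pos_eq (/ t n)) by lra.
    apply Rle_trans with (/ t n * (2 * (M * t n ^ 2) ^ 4)); [apply Rmult_le_compat_l; lra|].
    right. field. lra. }
  set (eta := fun n => X n * (1 + y n)).
  assert (Heta : bigO eventually t 7 (fun n => trunc_phase x (eta n) - m n)).
  { apply bigO_ext with (f := fun n => / t n * r n + t n ^ 7 *
     (1 / 2 * (2 * c0 n * c2 n + Y1 n ^ 2) - 1 / 6 * (Y1 n * (Y n ^ 2 + Y n * c0 n + c0 n ^ 2))
      - A0 x * c2 n + A0 x * (Y1 n * (Y n + c0 n)) - A0 x * (Y n ^ 3 * J n) - 3 * A1 x * Y1 n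
      + A1 x * (Y n ^ 2 * (6 + 8 * y n + 3 * y n ^ 2) * J n ^ 3)
      - A2 x * (Y n * (5 + 10 * y n + 10 * y n ^ 2 + 5 * y n ^ 3 + y n ^ 4) * J n ^ 5)));
      [typeclasses eauto| |].
    - generalize (filter_and _ _ Hxi Hy). apply filter_imp. intros n [[H1 [H2 H3]] H4].
      apply Rabs_lt_between in H4.
      assert (Tn : t n <> 0) by (apply Rgt_not_eq, Rinv_0_lt_compat; exact H1).
      symmetry. rewrite <- (trunc_phase_residual (t n) (D n) (y n) (J n) (c0 n) (c1 n) (c2 n)).
      + unfold trunc_phase, eta, r.
        replace (lambda x * (X n * (1 + y n))) with ((lambda x * X n) * (1 + y n)) by ring.
        rewrite ln_mult by nra.
        replace (ln (lambda x * X n)) with (D n - 1) by (unfold D; ring).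
        unfold J. rewrite !Rinv_mult. fold (t n). rewrite <- H3 at 1.
        replace (/ t n) with (X n) by (unfold t; field; lra). ring.
      + exact Tn.
      + unfold c0, b0. change (1 + ln (lambda x * xi x (m n))) with (D n). field. lra.
      + unfold c1, b1. change (1 + ln (lambda x * xi x (m n))) with (D n). unfold c0. field. lra.
      + unfold c2, b2. change (1 + ln (lambda x * xi x (m n))) with (D n). unfold c0, c1. field. lra.
      + unfold J. field. lra.
      + reflexivity.
    - apply bigO_plus; [typeclasses eauto|exact Br|].
      apply bigO_factor; [typeclasses eauto|exact Ht|]. bounded. }
  (* [nu >= xi / 2] converts the error [O(nu ^ -7)] into [O(xi ^ -7)]; below [xi / 2] the left side of
     the equation would be at most [m / 2]. *)
  assert (Hhalf : eventually (fun n => X n / 2 <= nu n)).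
  { assert (Hp : eventually (fun n => 0 < nu n)) by (apply (Hnu (fun v => 0 < v)); exists 0; auto).
    generalize (filter_and _ _ (filter_and _ _ Hp (Hm 2)) (filter_and _ _ Hxi Hlow)). apply filter_imp.
    intros n [[H0 H1] [[H2 [H3 H4]] H5]].
    destruct (Rle_lt_dec (X n / 2) (nu n)) as [G|G]; [exact G|exfalso].
    assert (ln (lambda x * nu n) <= D n - 1).
    { unfold D. replace (1 + ln (lambda x * X n) - 1) with (ln (lambda x * X n)) by ring.
      apply ln_le; [nra|]. apply Rmult_le_compat_l; lra. }
    assert (nu n * ln (lambda x * nu n) <= nu n * (D n - 1)) by (apply Rmult_le_compat_l; lra).
    assert (nu n * (D n - 1) <= X n / 2 * (D n - 1)) by (apply Rmult_le_compat_r; lra).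
    lra. }
  assert (Hres' : bigO eventually t 7 (fun n => trunc_phase x (nu n) - m n)).
  { destruct Hres as [M HM]. exists (Rabs M * 2 ^ 7).
    generalize (filter_and _ _ HM (filter_and _ _ Hxi Hhalf)). apply filter_imp.
    intros n [H1 [[H2 _] H3]]. apply Rle_trans with (1 := H1).
    assert (Hi : 0 < / nu n <= 2 * t n).
    { split; [apply Rinv_0_lt_compat; lra|]. unfold t.
      replace (2 * / X n) with (/ (X n / 2)) by (field; lra). apply Rinv_le_contravar; lra. }
    rewrite Rmult_assoc, <- Rpow_mult_distr.
    apply Rle_trans with (Rabs M * (/ nu n) ^ 7).
    - apply Rmult_le_compat_r; [apply pow_le; lra|apply Rle_abs].
    - apply Rmult_le_compat_l; [apply Rabs_pos|]. apply pow_incr. lra. }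
  assert (Hdiff : bigO eventually t 7 (fun n => nu n - eta n)).
  { destruct (trunc_phase_expanding x Hx) as [N [N0 HN]].
    apply bigO_le with (f := fun n => (trunc_phase x (nu n) - m n) - (trunc_phase x (eta n) - m n)); [typeclasses eauto| |].
    - assert (HnN : eventually (fun n => N < nu n)) by (apply (Hnu (fun v => N < v)); exists N; auto).
      assert (HxN : eventually (fun n => 2 * N < X n)) by (apply (HX (fun v => 2 * N < v)); exists (2 * N); auto).
      generalize (filter_and _ _ HnN (filter_and _ _ HxN Hy)). apply filter_imp.
      intros n [H1 [H2 H3]]. apply Rabs_lt_between in H3.
      match goal with |- _ <= Rabs ?e => replace e with (trunc_phase x (nu n) - trunc_phase x (eta n)) by ring end.
      apply HN; [lra|]. unfold eta. nra.
    - apply bigO_minus; [typeclasses eauto|exact Hres'|exact Heta]. }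
  assert (Hsplit : eventually (fun n => eta n = X n + (c0 n * t n + c1 n * t n ^ 3 + c2 n * t n ^ 5))).
  { generalize Hxi. apply filter_imp. intros n [H _]. unfold eta, y, Y, t. field. lra. }
  assert (Hconc : forall K S, (forall n, 0 < m n -> sum_f_R0 (fun k => B x (m n) k / m n ^ (2 * k + 1)) K = S n) ->
    bigO eventually t (2 * K + 3) (fun n => nu n - (X n + S n)) ->
    exists M : R, eventually (fun n =>
      Rabs (nu n - (xi x (m n) + sum_f_R0 (fun k => B x (m n) k / m n ^ (2 * k + 1)) K))
      <= M * / xi x (m n) ^ (2 * K + 3))).
  { intros K S HS [M HM]. exists M. generalize (filter_and _ _ (Hm 0) HM). apply filter_imp.
    intros n [H1 H2]. rewrite HS by exact H1. unfold t in H2. rewrite pow_inv in H2. exact H2. }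
  assert (HB : forall n, 0 < m n -> B x (m n) 0 / m n ^ 1 = c0 n * t n /\
     B x (m n) 1 / m n ^ 3 = c1 n * t n ^ 3 /\ B x (m n) 2 / m n ^ 5 = c2 n * t n ^ 5).
  { intros n Hn. apply (B_eq_b x (m n) Hx Hn). }
  intros K HK. destruct K as [|[|[|K]]]; [| | |lia].
  - apply (Hconc 0%nat (fun n => c0 n * t n)).
    + intros n Hn. destruct (HB n Hn) as [E0 _]. exact E0.
    + apply bigO_ext with (f := fun n => (nu n - eta n) + t n ^ 3 * (c1 n + c2 n * t n ^ 2)); [typeclasses eauto| |].
      * revert Hsplit. apply filter_imp. intros n E. rewrite E. ring.
      * apply bigO_plus; [typeclasses eauto| |].
        -- revert Hdiff. apply bigO_weaken; [typeclasses eauto|exact Ht|lia].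
        -- apply bigO_factor; [typeclasses eauto|exact Ht|]. bounded.
  - apply (Hconc 1%nat (fun n => c0 n * t n + c1 n * t n ^ 3)).
    + intros n Hn. destruct (HB n Hn) as [E0 [E1 _]]. rewrite tech5. f_equal; [exact E0|exact E1].
    + apply bigO_ext with (f := fun n => (nu n - eta n) + t n ^ 5 * c2 n); [typeclasses eauto| |].
      * revert Hsplit. apply filter_imp. intros n E. rewrite E. ring.
      * apply bigO_plus; [typeclasses eauto| |].
        -- revert Hdiff. apply bigO_weaken; [typeclasses eauto|exact Ht|lia].
        -- apply bigO_factor; [typeclasses eauto|exact Ht|]. bounded.
  - apply (Hconc 2%nat (fun n => c0 n * t n + c1 n * t n ^ 3 + c2 n * t n ^ 5)).
    + intros n Hn. destruct (HB n Hn) as [E0 [E1 E2]]. rewrite !tech5.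
      f_equal; [f_equal; [exact E0|exact E1]|exact E2].
    + revert Hdiff. apply bigO_ext; [typeclasses eauto|].
      revert Hsplit. apply filter_imp. intros n E. now rewrite E.
Qed.

Lemma zero_expansion_of_labels (x s : R) (Z : R -> C) (th m nu : nat -> R) (N : R) : 0 < x ->
  (forall n, th n = INR n * PI + s) -> (forall n, th n = m n + PI / 4) ->
  (forall v, N <= v -> (Z v = 0 <-> sin (bessel_phase x v - s) = 0)) ->
  labels_zeros x Z th nu -> zero_expansion x m nu.
Proof.
  intros Hx Hth Hm HZ Hlab.
  destruct (labels_zeros_phase x s Z th nu N Hx Hth HZ Hlab) as [Hinf Hph].
  apply zero_expansion_of_trunc_phase; [exact Hx| |exact Hinf| |].
  - intros M. generalize (eventually_PI_gt s (M + PI / 4)). apply filter_imp. intros n Hn.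
    rewrite <- Hth, Hm in Hn. lra.
  - destruct Hlab as [_ [_ Hlim]].
    pose proof (proj2 (is_lim_seq_spec _ _) Hlim (mkposreal 1 Rlt_0_1)) as H. simpl in H.
    revert H. apply filter_imp. intros n H. rewrite Rminus_0_r in H. apply Rabs_lt_between in H.
    rewrite Hm in H. unfold Phi in H. lra.
  - generalize (bigO_comp _ _ _ _ _ _ Hinf (bessel_phase_expand x Hx)).
    intros H. apply bigO_opp in H; [|typeclasses eauto]. revert H.
    apply bigO_ext; [typeclasses eauto|].
    revert Hph. apply filter_imp. intros n E. rewrite E, Hm. unfold Phi, trunc_phase. ring.
Qed.

Theorem theorem3 (x : R) (hx : 0 < x) :
  ((exists nu : nat -> R,
      labels_zeros x (BesselF x) (fun n => (INR n + 1 / 2) * PI) nu) /\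
   (forall nu : nat -> R,
      labels_zeros x (BesselF x) (fun n => (INR n + 1 / 2) * PI) nu ->
      zero_expansion x m_plus nu)) /\
  ((exists nu : nat -> R,
      labels_zeros x (BesselG x) (fun n => INR n * PI) nu) /\
   (forall nu : nat -> R,
      labels_zeros x (BesselG x) (fun n => INR n * PI) nu ->
      zero_expansion x m_minus nu)).
Proof.
  destruct (bessel_phase_monotone x) as [N [HN [HR [Hinc Hcont]]]].
  assert (HF : forall v, N <= v -> (BesselF x v = 0 <-> sin (bessel_phase x v - PI / 2) = 0)).
  { intros v Hv. apply BesselF_zero; [lra|now apply HR]. }
  assert (HG : forall v, N <= v -> (BesselG x v = 0 <-> sin (bessel_phase x v - 0) = 0)).
  { intros v Hv. apply BesselG_zero; [lra|now apply HR]. }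
  split; split.
  - apply (labels_zeros_exist x (PI / 2) _ _ N); auto. intros n. field.
  - intros nu. apply (zero_expansion_of_labels x (PI / 2) _ _ _ _ N); auto; intros n;
    unfold m_plus; field.
  - apply (labels_zeros_exist x 0 _ _ N); auto. intros n. ring.
  - intros nu. apply (zero_expansion_of_labels x 0 _ _ _ _ N); auto; intros n;
    unfold m_minus; field.
Qed.
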